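(* Let $C_n^{d,\alpha}$ be a hypercycle such that $d=2\alpha$. Then the non-zero Betti numbers of $R/I(C_n^{d,\alpha})$ are all in degrees $\alpha j$, where $j\le n$, and are as follows: (i) if $j<n$ and $2i\ge j$, then $$\beta_{i,\alpha j}(R/I(C_n^{d,\alpha}))=\frac{n}{n-2(j-i)}\binom{j-i}{2i-j}\binom{n-2(j-i)}{j-i};$$ (ii) if $n\equiv 1 \pmod 3$, then $\beta_{\frac{2n+1}{3},\alpha n}(R/I(C_n^{d,\alpha}))=1$; (iii) if $n\equiv 2\pmod 3$, then $\beta_{\frac{2n-1}{3},\alpha n}(R/I(C_n^{d,\alpha}))=1$; (iv) if $n\equiv 0\pmod 3$, then $\beta_{\frac{2n}{3},\alpha n}(R/I(C_n^{d,\alpha}))=2$.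
   Context: A hypergraph $\mathcal H$ consists of a finite vertex set $\mathcal X(\mathcal H)$ and a finite collection $\mathcal E(\mathcal H)$ of non-empty subsets of it, called edges; it is $d$-uniform if every edge has cardinality $d$. All hypergraphs are simple: every edge has at least $2$ vertices and no edge is contained in another edge. The hypercycle $C_n^{d,\alpha}$ is the $d$-uniform hypergraph with edge set $\{E_1,\dots,E_n\}$ and vertex set $\bigcup_{i=1}^n E_i$ such that (i) for any $i\ne j$, $E_i\cap E_j\neq\emptyset$ if and only if $j\equiv i-1$ or $j\equiv i+1 \pmod n$; (ii) $|E_i\cap E_{i+1}|=\alpha$ for all $1\le i\le n-1$ and $|E_1\cap E_n|=\alpha$. $R$ is the polynomial ring over a field $k$ whose variables are indexed by the vertices; for a set $F$ of vertices, $x^F=\prod_{v\in F}x_v$. The edge ideal is $I(\mathcal H)=(x^E : E\in\mathcal E(\mathcal H))$. $\beta_{i,j}(M)=\dim_k\mathrm{Tor}_i^R(M,k)_j$ are the $\mathbb N$-graded Betti numbers. A binomial coefficient $\binom ab$ is read as $0$ unless $0\le b\le a$.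
   Formalization: The formal theorem assumes n ≥ 3 and, when n = 3, that no vertex lies in all three edges; the claim fails otherwise (two edges meeting in α vertices for n = 2; the star K_{1,3} with d = 2, α = 1 for n = 3, where β_{2,3} = 3). *)

(* Defs.v *)
From mathcomp Require Import all_boot all_order all_algebra.
From mathcomp Require Export mpoly.
From Stdlib Require Import ClassicalEpsilon.

Set Implicit Arguments.
Unset Strict Implicit.
Unset Printing Implicit Defensive.

Import GRing.Theory.
Local Open Scope ring_scope.

Record hypergraph := Hypergraph {
  vertex :> finType;
  edges : {set {set vertex}};
  edges_gt1 : forall E, E \in edges -> (1 < #|E|)%N;
  edges_antichain :
    forall E F, E \in edges -> F \in edges -> E \subset F -> E = F
}.

Definition uniform (d : nat) (H : hypergraph) : Prop :=
  forall E, E \in edges H -> #|E| = d.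

(* [H] is a hypercycle C_n^{d,alpha}; the edge E_i of the usual numbering
   1, ..., n is [E] at the ordinal i - 1. *)
Definition is_hypercycle (n d alpha : nat) (H : hypergraph) : Prop :=
  uniform d H /\
  exists E : 'I_n -> {set vertex H},
    [/\ edges H = [set E i | i : 'I_n],
        \bigcup_(i < n) E i = [set: vertex H],
        forall i j : 'I_n, i != j ->
          (E i :&: E j != set0 <->
           (j.+1 = i %[mod n])%N \/ (j = i.+1 %[mod n])%N),
        forall i j : 'I_n, nat_of_ord j = i.+1 -> #|E i :&: E j| = alpha &
        forall i j : 'I_n, nat_of_ord i = 0%N -> j.+1 = n ->
          #|E i :&: E j| = alpha].

(* The variable attached to a vertex v of H is 'X_(enum_rank v). *)
Definition set_monomial (k : fieldType) (H : hypergraph) (F : {set vertex H}) :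
  {mpoly k[#|vertex H|]} := \prod_(v in F) 'X_(enum_rank v).

Definition edge_ideal (k : fieldType) (H : hypergraph)
    (p : {mpoly k[#|vertex H|]}) : Prop :=
  exists c : {set vertex H} -> {mpoly k[#|vertex H|]},
    p = \sum_(E in edges H) c E * set_monomial k E.

(* An N-graded sequence of maps of degree 0 between free modules
     ... -> F_1 -> F_0 -> R / I,   F_i = \bigoplus_a R (- gdeg i a),
   over the standard graded polynomial ring R = k[X_0, ..., X_(m-1)].
   Elements of F_i are row vectors and maps act by right multiplication.  The
   map F_0 -> R / I is given by representatives [aug] in R of the images of the
   basis vectors. *)
Record graded_free_seq (k : fieldType) (m : nat) := GradedFreeSeq {
  rk : nat -> nat;
  gdeg : forall i, 'I_(rk i) -> nat;
  diff : forall i, 'M[{mpoly k[m]}]_(rk i.+1, rk i);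
  aug : 'cV[{mpoly k[m]}]_(rk 0);
  diff_homog : forall i a b u,
    u \in msupp (diff i a b) -> (mdeg u + gdeg b)%N = gdeg a;
  aug_homog : forall a u, u \in msupp (aug a 0) -> mdeg u = gdeg a
}.

Arguments gdeg {k m} g i _.

(* Exactness of ... -> F_1 -> F_0 -> R / I -> 0. *)
Definition resolves (k : fieldType) (m : nat) (F : graded_free_seq k m)
    (I : {mpoly k[m]} -> Prop) : Prop :=
  [/\ forall p, exists v : 'rV_(rk F 0), I (p - (v *m aug F) 0 0),
      forall v : 'rV_(rk F 0),
        I ((v *m aug F) 0 0) <-> exists w, v = w *m diff F 0 &
      forall i (v : 'rV_(rk F i.+1)),
        v *m diff F i = 0 <-> exists w, v = w *m diff F i.+1].

Section TensorWithResidueField.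

Variables (k : fieldType) (m : nat) (F : graded_free_seq k m).

(* F_i tensored with k = R / (X_0, ..., X_(m-1)) is k^(rk i), and the maps are
   read modulo the variables, i.e. through their constant coefficients. *)
Definition tdiff (i : nat) : 'M[k]_(rk F i.+1, rk F i) :=
  map_mx (mcoeff 0%MM) (diff F i).

(* Row space: the degree j component of F_i tensored with k. *)
Definition tpart (i j : nat) : 'M[k]_(rk F i) :=
  diag_mx (\row_a (gdeg F i a == j)%:R).

Definition tcycles (i j : nat) : 'M[k]_(rk F i) :=
  match i with
  | 0 => tpart 0 j
  | i'.+1 => (tpart i'.+1 j :&: kermx (tdiff i'))%MS
  end.

Definition tboundaries (i j : nat) : 'M[k]_(rk F i.+1, rk F i) :=
  tpart i.+1 j *m tdiff i.

Definition tor_dim (i j : nat) : nat :=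
  (\rank (tcycles i j) - \rank (tboundaries i j))%N.

End TensorWithResidueField.

(* beta_{i,j}(R / I) = dim_k Tor_i^R(R / I, k)_j, with Tor computed, as usual,
   from some graded free resolution of R / I; the choice is immaterial. *)
Definition betti (k : fieldType) (m : nat) (I : {mpoly k[m]} -> Prop)
    (i j : nat) : nat :=
  epsilon (inhabits 0%N)
    (fun b => exists F : graded_free_seq k m,
       resolves F I /\ tor_dim F i j = b).

(* The binomial coefficient, read as 0 unless 0 <= b <= a. *)
Definition binz (a b : int) : nat :=
  if (0 <= b <= a)%R then 'C(`|a|%N, `|b|%N) else 0%N.

(* Main.v *)
Require Import Defs.
From mathcomp Require Import all_boot all_order all_algebra.
From mathcomp Require Import zify.
From Stdlib Require Import ClassicalEpsilon.

(** Any two graded free resolutions of R/I are homotopy equivalent through maps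
    of degree 0, so the Betti numbers can be read off the Taylor resolution of
    the edge ideal: they count the homology of the complex with basis the sets S
    of edges, graded by the size of S and by the union of S, whose differential
    deletes an edge when that does not change the union.

    Since d = 2 alpha, the edge E_i is the disjoint union of two blocks of size
    alpha, shared with E_(i-1) and E_(i+1).  So S is a cyclic 0/1 word, and the
    letter 1 in 111 can be deleted.  Reading the word from a place that only
    depends on the covered blocks, we match S with the set obtained by toggling
    the letter x in the first occurrence of 01x1.  This matching is acyclic and
    in each multidegree the critical sets (those that avoid 01x1) all have the
    same size, so they form a basis of the homology.

    A critical set that does not cover everything consists of runs 1 or 11 whose
    starting points are at cyclic distance at least 3; with r = j - i runs,
    2i - j of which are long, this gives the binomial formula.  The critical sets
    covering everything are the words 011011... and 110110..., each of them being
    allowed in two of the three residue classes of n modulo 3. *)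

Set Implicit Arguments.
Unset Strict Implicit.
Unset Printing Implicit Defensive.

(** * Words avoiding 01x1 *)

Section LinearWords.

Implicit Types (w : nat -> bool) (p q t : nat).

(** The letter at [p.+2] is left free: it is the one that the matching toggles. *)
Definition occurs w p := [&& ~~ w p, w p.+1 & w p.+3].

Definition first_occurrence w p := occurs w p /\ forall q, q < p -> ~~ occurs w q.

Lemma first_occurrence_uniq w p q :
  first_occurrence w p -> first_occurrence w q -> p = q.
Proof.
move=> [op fp] [oq fq]; case: (ltngtP p q) => // lt.
  by have := fq _ lt; rewrite op.
by have := fp _ lt; rewrite oq.
Qed.

(** An occurrence at [q < p] can involve the letter at [p.+2] only as its last letter. Then
    [q.+1 = p], where the word has a 0 instead of a 1. *)
Lemma first_occurrence_toggle w w' p :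
  (forall t, t != p.+2 -> w' t = w t) ->
  first_occurrence w p -> first_occurrence w' p.
Proof.
move=> e [/and3P[w0 w1 w3] fp]; split; first by rewrite /occurs !e ?w0 ?w1 //; lia.
move=> q qp; apply: contra (fp q qp); rewrite /occurs => /and3P[v0 v1 v3].
have qp1 : q.+3 != p.+2.
  by apply/eqP => -[eq]; move: v1; rewrite eq e ?(negPf w0) //; lia.
by rewrite -!e ?v0 ?v1 //; lia.
Qed.

(** Walking left from the block 111, the first 0 met starts a factor 0111. Such a 0 exists because
    the word begins with one. *)
Lemma occurs_before_111 w t : ~~ w 0 -> w t -> w t.+1 -> w t.+2 ->
  exists2 q, q < t & occurs w q.
Proof.
move=> w0; elim: t => [|t IH]; first by rewrite (negPf w0).
move=> w1 w2 w3; case wt: (w t).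
  by have [q qt oq] := IH wt w1 w2; exists q => //; lia.
by exists t => //; rewrite /occurs wt w1 w3.
Qed.

(** The word form of acyclicity. An occurrence of [w'] before [p] would be created by the deletion,
    hence start at the deleted letter; but then [w] has an even earlier occurrence, to the left of
    its block 111. An occurrence at [p] itself is excluded by the letter at [p.+2]. *)
Lemma first_occurrence_lt w w' p p' t :
  ~~ w 0 -> first_occurrence w p -> w p.+2 -> t.+1 != p.+2 ->
  w t -> w t.+1 -> w t.+2 -> (forall u, w' u = w u && (u != t.+1)) ->
  first_occurrence w' p' -> ~~ w' p'.+2 -> p < p'.
Proof.
move=> w0 [op fp] wp tp wt wt1 wt2 e [/and3P[v0 v1 v3] _] v2.
rewrite ltnNge; apply/negP => le.
have {le} lt : p' < p.
  rewrite ltn_neqAle le andbT; apply/eqP => eq; move: v2.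
  by rewrite eq e wp eq_sym tp.
move: v1 v3; rewrite !e => /andP[v1 _] /andP[v3 _].
have {v0} eq : p' = t.+1.
  apply/eqP; apply: contraT => ne; have := fp _ lt.
  by rewrite /occurs v1 v3; move: v0; rewrite e ne andbT => ->.
have [q qt oq] := occurs_before_111 w0 wt wt1 wt2.
by have := fp q; rewrite oq => /(_ _)/implyP; lia.
Qed.

(* After a 0 the next letter is read off the covering; in 01x the letter x is
   read off the covering of the following position, since a 0 comes next. *)
Lemma avoiding_word_uniq w v :
  ~~ w 0 -> ~~ v 0 -> (forall p, ~~ occurs w p) -> (forall p, ~~ occurs v p) ->
  (forall t, w t || w t.+1 = v t || v t.+1) -> w =1 v.
Proof.
move=> w0 v0 aw av cov.
suff h t : forall u, u < t -> w u = v u by move=> t; apply: (h t.+1).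
elim: t => [//|t IH] u; rewrite ltnS leq_eqVlt => /orP[/eqP->{u}|]; last exact: IH.
case: t IH => [|t] IH; first by rewrite (negPf w0) (negPf v0).
have e0 := IH t (ltnSn _).
case wt: (w t); last first.
  by have := cov t; rewrite -e0 wt.
case: t IH e0 wt => [|t] IH e0 wt; first by rewrite wt in w0.
have e1 : w t = v t by apply: IH; lia.
case wt': (w t).
  have no x : ~~ x 0 -> (forall p, ~~ occurs x p) -> x t -> x t.+1 -> x t.+2 = false.
    move=> x0 ax h0 h1; apply/negP => h2.
    by have [q _] := occurs_before_111 x0 h0 h1 h2; rewrite (negPf (ax q)).
  by rewrite !no -?e0 -?e1.
have := aw t; have := av t; rewrite /occurs -e0 -e1 wt wt' /= => /negPf h1 /negPf h2.
by have := cov t.+2; rewrite h1 h2 !orbF.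
Qed.

(** From a 0 at [3 * a], covering forces a 1 next and avoidance forces a 0 three places further. The
    letter before that 0 is then a 1, by covering or, at the end of the word, by [w M]. *)
Lemma avoiding_full_word w M :
  ~~ w 0 -> w M -> (forall p, ~~ occurs w p) ->
  (forall t, t < M -> w t || w t.+1) -> forall t, t <= M -> w t = (t %% 3 != 0).
Proof.
move=> w0 wM aw cov.
suff h a : forall t, t <= M -> t <= 3 * a -> w t = (t %% 3 != 0).
  by move=> t tM; apply: (h t) => //; lia.
elim: a => [|a IH] t tM ta; first by rewrite (_ : t = 0) ?(negPf w0) //; lia.
have [le|lt] := leqP t (3 * a); first exact: IH.
have w3 : ~~ w (3 * a) by rewrite IH //; lia.
have w31 : w (3 * a).+1 by have := cov (3 * a); rewrite (negPf w3); apply; lia.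
have w33 : ~~ w (3 * a).+3 by have := aw (3 * a); rewrite /occurs w3 w31.
have [->|n1] := eqVneq t (3 * a).+1; first by rewrite w31; lia.
have [->|n2] := eqVneq t (3 * a).+3; first by rewrite (negPf w33); lia.
have te : t = (3 * a).+2 by lia.
have [Me|lM] : (3 * a).+2 = M \/ (3 * a).+2 < M by lia.
  by rewrite te Me wM; lia.
by rewrite te; have := cov _ lM; rewrite (negPf w33) orbF => ->; lia.
Qed.

End LinearWords.

(** * The matching on sets of edges of a cycle *)

Lemma find_first_occurrence (w : nat -> bool) L :
  if find (occurs w) (iota 0 L) < L
  then first_occurrence w (find (occurs w) (iota 0 L))
  else forall q, q < L -> ~~ occurs w q.
Proof.
set p := find _ _; case: ifP => pL.
  have hp : has (occurs w) (iota 0 L) by rewrite has_find size_iota.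
  split=> [|q qp]; first by have := nth_find 0 hp; rewrite nth_iota.
  have := before_find 0 qp; rewrite nth_iota ?add0n => [->//|].
  exact: ltn_trans pL.
move=> q qL; move: pL; rewrite -[in X in X -> _](size_iota 0 L) -has_find => /hasPn.
by apply; rewrite mem_iota.
Qed.

Section CyclicWords.

Variable m : nat.
Hypothesis m_ge2 : 2 <= m.
Local Notation n := m.+1.
Implicit Types (S T : {set 'I_n}) (e f : 'I_n) (b : bool) (r t u p : nat).

(* Edge e of the cycle joins the vertices e and e + 1. *)
Definition covered S : {set 'I_n} := [set v | (v \in S) || (inZp (v + m) \in S)].

Lemma inZp_inj_mod t u : (inZp t = inZp u :> 'I_n) <-> t %% n = u %% n.
Proof. by split=> [/(congr1 val)|h]; last exact: val_inj. Qed.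

Lemma inZpD t u : inZp ((inZp t : 'I_n) + u) = inZp (t + u) :> 'I_n.
Proof. by apply/inZp_inj_mod; rewrite /= modnDml. Qed.

Lemma inZpS t : inZp (inZp t : 'I_n).+1 = inZp t.+1 :> 'I_n.
Proof. by rewrite -[in LHS]addn1 inZpD addn1. Qed.

Lemma inZpS2 t : inZp (inZp t : 'I_n).+2 = inZp t.+2 :> 'I_n.
Proof. by rewrite -[in LHS]addn2 inZpD addn2. Qed.

Lemma inZpDn t : inZp (t + n) = inZp t :> 'I_n.
Proof. by apply/inZp_inj_mod; rewrite modnDr. Qed.

(** Adding [m] is stepping back by one modulo [n]. *)
Lemma cover_inZp S t :
  (inZp t \in covered S) = (inZp t \in S) || (inZp (t + m) \in S).
Proof. by rewrite inE inZpD. Qed.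

Lemma cover_inZpS S t :
  (inZp t.+1 \in covered S) = (inZp t \in S) || (inZp t.+1 \in S).
Proof. by rewrite cover_inZp addSnnS inZpDn orbC. Qed.

Lemma pred_neq e : inZp (e + m) != e.
Proof.
rewrite -[X in _ != X]valZpK; apply/eqP => /inZp_inj_mod /eqP.
by rewrite -[X in _ == X %[mod _]]addn0 eqn_modDl mod0n modn_small //; lia.
Qed.

Lemma succ_neq e : inZp e.+1 != e.
Proof.
rewrite -[X in _ != X]valZpK; apply/eqP => /inZp_inj_mod /eqP.
by rewrite -[e.+1]addn1 -[X in _ == X %[mod _]]addn0 eqn_modDl mod0n modn_small //; lia.
Qed.

(** Both vertices of [e] stay covered by its two neighbours. *)
Lemma cover_toggle S e :
  inZp (e + m) \in S -> inZp e.+1 \in S -> covered (e |: S) = covered (S :\ e).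
Proof.
move=> pS sS; apply/setP => v; rewrite !inE.
have [->|ve] := eqVneq v e; first by rewrite pS pred_neq orbT.
have [ve'|ve'] /= := eqVneq (inZp (v + m)) e; last by [].
have -> : v = inZp e.+1.
  by rewrite -ve' inZpS -addnS inZpDn valZpK.
by rewrite sS.
Qed.

(** Without [e], each of its two vertices can only be covered by the neighbouring edge on that
    side. *)
Lemma cover_setD1 S e : e \in S -> covered (S :\ e) = covered S ->
  (inZp (e + m) \in S) && (inZp e.+1 \in S).
Proof.
move=> eS ce; apply/andP; split.
  have : e \in covered (S :\ e) by rewrite ce inE eS.
  by rewrite !inE eqxx /= => /andP[].
have : inZp e.+1 \in covered (S :\ e) by rewrite ce cover_inZpS valZpK eS.
by rewrite cover_inZpS valZpK !inE eqxx /= => /andP[].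
Qed.

Lemma inZp_offset e f : exists2 t, t < n & e = inZp (f + t).
Proof.
exists ((e + n - f) %% n); first by rewrite ltn_mod.
rewrite -[LHS]valZpK; apply/inZp_inj_mod; rewrite modnDmr subnKC ?modnDr //.
by rewrite ltnW // ltn_addl.
Qed.

(** The place from which the word is read. It depends on [S] only through [covered S], so toggling a
    pivot does not move it. The default [ord0] is used exactly when everything is covered. *)
Definition base S : 'I_n := odflt ord0 [pick v | v \notin covered S].

Lemma base_cover S T : covered S = covered T -> base S = base T.
Proof. by rewrite /base => ->. Qed.

Lemma base_in S : base S \in S -> covered S = setT /\ base S = ord0.
Proof.
rewrite /base; case: pickP => [v vS|full] /=.
  by move: vS; rewrite inE negb_or => /andP[/negPf->].
move=> _; split=> //; apply/setP => v.
by rewrite (negbFE (full v)) inE.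
Qed.

Lemma base_notin S : covered S != setT -> base S \notin covered S.
Proof.
rewrite /base; case: pickP => [v //|full] /=; rewrite -subTset => /subsetPn[v _].
by rewrite (negbFE (full v)).
Qed.

(* The word of S read from position r; when b holds the edge r is present, the
   word then starts with an extra 0 and ends with a second copy of edge r. *)
Definition idx r b t : 'I_n := inZp (r + (t - b)).
Definition dom b t := b <= t < n + 2 * b.
Definition word r b S t := dom b t && (idx r b t \in S).
Definition core b t := 0 < t - b < n.

Lemma core_dom b t : core b t -> dom b t.
Proof. by rewrite /core /dom; case: b; lia. Qed.

Lemma core_dom3 b u : b <= u -> u.+2 < n + 2 * b ->
  [/\ core b u.+1, dom b u & dom b u.+2].
Proof. by rewrite /core /dom; case: b => bu un; split; lia. Qed.

Lemma word0 S : ~~ word (base S) (base S \in S) S 0.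
Proof.
rewrite /word; case: (boolP (base S \in S)) => // bS.
by rewrite /idx subn0 addn0 valZpK (negPf bS) andbF.
Qed.

(** Only the edge [r] may be read twice, at the two ends of the word. The positions in [core] are
    those that read another edge. *)
Lemma idx_inj r b t u : dom b t -> core b u -> idx r b t = idx r b u -> t = u.
Proof.
move=> dt cu /inZp_inj_mod /eqP; rewrite eqn_modDl => /eqP.
move: dt cu; rewrite /dom /core => /andP[bt tn] /andP[u0 un].
rewrite [RHS]modn_small // => h.
have [lt|ge] := ltnP (t - b) n; first by rewrite modn_small // in h; lia.
(* The remaining position is the second copy of [r], which exists when [b] holds. *)
have e : t - b = n by case: b {h} bt tn u0 un ge => /=; lia.
by rewrite e modnn in h; rewrite -h in u0.
Qed.

Lemma idx_neq r b u : core b u -> idx r b u != inZp r.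
Proof.
rewrite /core => /andP[u0 un]; apply/eqP => /inZp_inj_mod /eqP.
rewrite -[X in _ == X %[mod _]]addn0 eqn_modDl mod0n modn_small //.
by rewrite -[_ == _]negbK -lt0n u0.
Qed.

Lemma word_setD1 r b S t u : core b u ->
  word r b (S :\ idx r b u) t = word r b S t && (t != u).
Proof.
move=> cu; rewrite /word; case dt: (dom b t) => //=; rewrite !inE andbC; congr (_ && ~~ _).
by apply/eqP/eqP => [/idx_inj|->//]; apply.
Qed.

Lemma word_setU1 r b S t u : core b u ->
  word r b (idx r b u |: S) t = word r b S t || (t == u).
Proof.
move=> cu; rewrite /word; case dt: (dom b t) => /=; last first.
  by symmetry; apply: contraFF dt => /eqP->; exact: core_dom.
rewrite !inE orbC; congr (_ || _).
by apply/eqP/eqP => [/idx_inj|->//]; apply.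
Qed.

Lemma idx_pred r b t : b <= t -> inZp (idx r b t.+1 + m) = idx r b t.
Proof. by move=> bt; rewrite /idx inZpD subSn // addnS addSnnS inZpDn. Qed.

Lemma idx_succ r b t : b <= t -> inZp (idx r b t).+1 = idx r b t.+1.
Proof. by move=> bt; rewrite /idx inZpS subSn // addnS. Qed.

Definition cword S := word (base S) (base S \in S) S.
Definition first_pos S := find (occurs (cword S)) (iota 0 n.+2).
Definition pivot S : option 'I_n :=
  if first_pos S < n.+2 then Some (idx (base S) (base S \in S) (first_pos S).+2)
  else None.
(* A gradient step can remove the edge base S, but never add it. *)
Definition weight S := if base S \in S then first_pos S else first_pos S + n.+2.

(** Since [p.+3] still lies in the word, the toggled position [p.+2] is interior and reads an edge
    other than [r]. *)
Lemma occurs_core r b S p : occurs (word r b S) p -> core b p.+2.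
Proof.
rewrite /occurs /word /dom /core => /and3P[_ _ /andP[/andP[_ lt] _]].
by case: b lt => /=; lia.
Qed.

Lemma occurs_lt r b S p : occurs (word r b S) p -> p < n.+2.
Proof. by move=> /occurs_core; rewrite /core; case: b; lia. Qed.

Lemma first_pos_uniq S p : first_occurrence (cword S) p -> first_pos S = p.
Proof.
move=> fp; have := find_first_occurrence (cword S) n.+2; rewrite -/(first_pos S).
case: ifP => [_ fq|_ no] /=; first exact: first_occurrence_uniq fp.
by have := no p (occurs_lt fp.1); rewrite fp.1.
Qed.

Lemma pivotP S e : pivot S = Some e <->
  first_occurrence (cword S) (first_pos S) /\
  e = idx (base S) (base S \in S) (first_pos S).+2.
Proof.
have := find_first_occurrence (cword S) n.+2; rewrite -/(first_pos S) /pivot.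
case: ifP => [lt fp|ge no] /=; first by split=> [[<-]|[_ ->]].
split=> // -[[op _] _]; by have := no _ (occurs_lt op); rewrite op.
Qed.

Lemma pivotN S : pivot S = None <-> forall p, ~~ occurs (cword S) p.
Proof.
have := find_first_occurrence (cword S) n.+2; rewrite -/(first_pos S) /pivot.
case: ifP => [lt [op _]|ge no] /=.
  by split=> // /(_ (first_pos S)); rewrite op.
split=> // _ p; by apply/negP => op; have := no p (occurs_lt op); rewrite op.
Qed.

Lemma pivot_cover S e : pivot S = Some e -> covered (e |: S) = covered (S :\ e).
Proof.
move=> /pivotP[[op _] ->]; have co := occurs_core op.
case/and3P: op => _ /andP[_ w1] /andP[_ w3]; move: co w1 w3.
rewrite /core; set b := base S \in S; set p := first_pos S => co w1 w3.
apply: cover_toggle; first by rewrite idx_pred //; case: b {w1 w3} co; lia.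
by rewrite idx_succ //; case: b {w1 w3} co; lia.
Qed.

Lemma pivot_cover_same S e : pivot S = Some e ->
  covered (e |: S) = covered S /\ covered (S :\ e) = covered S.
Proof.
move=> /pivot_cover eq; have [eS|eS] := boolP (e \in S).
  by rewrite -eq (setUidPr _) ?sub1set.
by rewrite eq (setDidPl _) // disjoint_sym disjoints1.
Qed.

Lemma pivot_base S e : pivot S = Some e -> base S != e.
Proof.
move=> /pivotP[[op _] ->]; rewrite eq_sym -[X in _ != X]valZpK.
exact/idx_neq/(occurs_core op).
Qed.

(** With the same covering and the same status of the edge [base S], both words are read in the same
    way, and [first_occurrence_toggle] applies. *)
Lemma pivot_same S T e : pivot S = Some e -> covered T = covered S ->
  (base S \in T) = (base S \in S) ->
  (forall t, t != (first_pos S).+2 ->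
    word (base S) (base S \in S) T t = word (base S) (base S \in S) S t) ->
  first_pos T = first_pos S /\ pivot T = Some e.
Proof.
move=> /pivotP[fp ->] cT bT eqw.
have fT : first_occurrence (cword T) (first_pos S).
  by rewrite /cword (base_cover cT) bT; apply: first_occurrence_toggle fp.
have eT : first_pos T = first_pos S by apply: first_pos_uniq.
split=> //; apply/pivotP; rewrite eT; split=> //.
by rewrite (base_cover cT) bT.
Qed.

Lemma pivot_setU1 S e : pivot S = Some e ->
  first_pos (e |: S) = first_pos S /\ pivot (e |: S) = Some e.
Proof.
move=> pS; have [c1 _] := pivot_cover_same pS.
apply: (pivot_same pS) => //.
  by rewrite !inE (negPf (pivot_base pS)).
case/pivotP: pS => [[op _] ->] t tp; rewrite word_setU1 ?(negPf tp) ?orbF //.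
exact: occurs_core op.
Qed.

Lemma pivot_setD1 S e : pivot S = Some e ->
  first_pos (S :\ e) = first_pos S /\ pivot (S :\ e) = Some e.
Proof.
move=> pS; have [_ c1] := pivot_cover_same pS.
apply: (pivot_same pS) => //.
  by rewrite !inE (pivot_base pS).
case/pivotP: pS => [[op _] ->] t tp; rewrite word_setD1 ?tp ?andbT //.
exact: occurs_core op.
Qed.

(** A gradient step goes down from [S] by deleting [f] and up to [T] by adding [e']; the increase of
    the weight shows that no gradient path closes up. Deleting [base S] gains the summand [n.+2],
    which exceeds [first_pos S]. Deleting any other edge is handled by [first_occurrence_lt]. *)
Lemma weight_lt S T e e' f :
  pivot S = Some e -> e \in S -> pivot T = Some e' -> e' \in T -> S != T ->
  f \in S -> S :\ f = T :\ e' -> covered (S :\ f) = covered S ->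
  weight S < weight T.
Proof.
move=> pS eS pT eT ST fS eq cf.
have [_ cT] := pivot_cover_same pT.
have bST : base T = base S by apply: base_cover; rewrite -cT -eq.
have bT' : (base S \in T) = (base S \in S :\ f).
  by rewrite eq !inE -bST (pivot_base pT).
have lS : first_pos S < n.+2 by move: pS; rewrite /pivot; case: ifP.
rewrite /weight bST bT' !inE.
have [<-|fb] /= := eqVneq f (base S).
  by rewrite fS; apply: leq_trans lS _; rewrite leq_addl.
rewrite eq_sym in fb.
suff lt : first_pos S < first_pos T by case: ifP => _ //; rewrite ltn_add2r.
(* Otherwise [S] and [T] would both be the partner of [S :\ f], hence equal. *)
have fe : f != e.
  apply: contraNneq ST => fe; rewrite -(setD1K fS) -(setD1K eT) eq; apply/eqP.
  congr ([set _] :|: _); have [_ h1] := pivot_setD1 pS.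
  have [_] := pivot_setD1 pT; rewrite -eq fe h1 => -[->//].
have [fpT pT1] := pivot_setD1 pT; rewrite -fpT.
case/andP: (cover_setD1 fS cf) => pf sf.
have [fw _] := (pivotP _ _).1 pT1.
have [fpS ee] := (pivotP _ _).1 pS.
have cwT : cword (T :\ e') = word (base S) (base S \in S) (S :\ f).
  by rewrite /cword -eq (base_cover cf) !inE fb.
set b := base S \in S in cwT ee.
(* f is read at position u.+1, away from both ends of the word *)
have [u fu] : exists u, [/\ f = idx (base S) b u.+1, b <= u & u.+2 < n + 2 * b].
  have [a an /esym ea] := inZp_offset f (base S).
  have a0 : a != 0.
    by apply: contraNneq fb => a0; rewrite -ea a0 addn0 valZpK.
  have [bS|bS] := boolP b.
    by exists a; rewrite /idx subn1 /= ea lt0n a0 muln1 addn2 2!ltnS an.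
  exists a.-1; rewrite /idx subn0 prednK ?lt0n // ea; split=> //.
  rewrite muln0 addn0 ltn_neqAle an andbT.
  (* If [f] were the last edge read, its successor [base S] would belong to [S]. *)
  apply: contraNneq bS => aE; rewrite /b -[base S]valZpK.
  by move: sf; rewrite -ea inZpS -addnS aE inZpDn.
case: fu => fu bu un.
have [cu d0 d2] := core_dom3 bu un.
apply: (@first_occurrence_lt (cword S) (cword (T :\ e')) _ _ u (word0 S) fpS) => //.
- by rewrite /cword -/b /word -ee eS core_dom //; apply: occurs_core fpS.1.
- apply: contra fe => /eqP ue; rewrite ee fu ue //.
- by rewrite /cword /word -/b d0 -idx_pred // -fu.
- by rewrite /cword /word -/b (core_dom cu) -fu.
- by rewrite /cword /word -/b d2 -idx_succ ?leqW // -fu.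
- by move=> t; rewrite cwT fu word_setD1.
have [_ e'E] := (pivotP _ _).1 pT1; rewrite /cword /word -e'E.
by rewrite !inE eqxx andbF.
Qed.

(** * Critical sets covering every vertex *)

Implicit Types (R : {set 'I_n}) (v : 'I_n) (i j : nat).

(** The cyclic word 011011... for [c = 0] and 110110... for [c = 1], read from edge 0. *)
Definition full_crit c : {set 'I_n} := [set i : 'I_n | (i + c) %% 3 != 0].

Lemma inZp_full_crit c t : t < n -> (inZp t \in full_crit c) = ((t + c) %% 3 != 0).
Proof. by move=> tn; rewrite inE /= (modn_small tn). Qed.

Lemma inZpn : inZp n = ord0 :> 'I_n.
Proof. by apply/val_inj; rewrite /= modnn. Qed.

Lemma inZp0 : inZp 0 = ord0 :> 'I_n.
Proof. by apply/val_inj; rewrite /= mod0n. Qed.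

Lemma base_full S : covered S = setT -> base S = ord0.
Proof. by rewrite /base => ->; case: pickP => // v; rewrite inE. Qed.

Lemma word_ord0 b S t : word (ord0 : 'I_n) b S t = dom b t && (inZp (t - b) \in S).
Proof. by rewrite /word /idx add0n. Qed.

(** By [avoiding_full_word] the whole word is determined. Its last letter, which is the second copy
    of edge 0 if this edge is present and the edge [m] otherwise, is a 1, and this excludes one
    residue of [n] modulo 3. *)
Lemma full_crit_sub S : covered S = setT -> pivot S = None ->
  S = full_crit 0 /\ n %% 3 != 1 \/ S = full_crit 1 /\ n %% 3 != 2.
Proof.
move=> cS /pivotN; rewrite /cword (base_full cS) => avoid.
have w0 := word0 S; rewrite (base_full cS) in w0.
have cov t : (inZp t \in S) || (inZp t.+1 \in S) by rewrite -cover_inZpS cS inE.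
have [S0|S0] := boolP (ord0 \in S); rewrite ?S0 ?(negPf S0) in w0 avoid.
  right; have wE t : word (ord0 : 'I_n) true S t.+1 = (t <= n) && (inZp t \in S).
    by rewrite word_ord0 /dom muln1 addn2 subn1 /= !ltnS.
  have h1 : word (ord0 : 'I_n) true S n.+1 by rewrite wE leqnn inZpn.
  have h2 t : t < n.+1 -> word (ord0 : 'I_n) true S t || word (ord0 : 'I_n) true S t.+1.
    rewrite wE; case: t => [_|t tn]; first by rewrite inZp0 S0 orbT.
    by rewrite ltnS in tn; rewrite wE tn (ltnW tn) cov.
  have h t : t <= n -> (inZp t \in S) = ((t + 1) %% 3 != 0).
    by move=> tn; have := avoiding_full_word w0 h1 avoid h2 (t := t.+1); rewrite wE tn addn1; apply.
  split; last by have := h n (leqnn n); rewrite inZpn S0; lia.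
  by apply/setP => v; rewrite inE -h ?valZpK // ltnW.
left; have wE t : word (ord0 : 'I_n) false S t = (t <= m) && (inZp t \in S).
  by rewrite word_ord0 /dom muln0 addn0 subn0 /= ltnS.
have Sm : inZp m \in S by have := cov m; rewrite inZpn (negPf S0) orbF.
have h1 : word (ord0 : 'I_n) false S m by rewrite wE leqnn Sm.
have h2 t : t < m -> word (ord0 : 'I_n) false S t || word (ord0 : 'I_n) false S t.+1.
  by move=> tm; rewrite !wE tm (ltnW tm) cov.
have h t : t <= m -> (inZp t \in S) = (t %% 3 != 0).
  by move=> tm; have := avoiding_full_word w0 h1 avoid h2 tm; rewrite wE tm.
split; last by have := h m (leqnn m); rewrite Sm; lia.
by apply/setP => v; rewrite inE addn0 -h ?valZpK // -ltnS.
Qed.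

Lemma cover_full_crit c : (c == 0) && (n %% 3 != 1) || (c == 1) && (n %% 3 != 2) ->
  covered (full_crit c) = setT.
Proof.
move=> hc; apply/setP => v; rewrite [RHS]inE -[v]valZpK cover_inZp.
have vn := ltn_ord v.
case: (nat_of_ord v) vn => [|u] un.
  rewrite add0n !inZp_full_crit //; case/orP: hc => /andP[/eqP->]; lia.
rewrite addSnnS inZpDn !inZp_full_crit //; lia.
Qed.

Lemma pivot_full_crit c : (c == 0) && (n %% 3 != 1) || (c == 1) && (n %% 3 != 2) ->
  pivot (full_crit c) = None.
Proof.
move=> hc; apply/pivotN => p; rewrite /cword (base_full (cover_full_crit hc)).
rewrite -[ord0 \in _]/(ord0 \in full_crit c).
case/orP: hc => /andP[/eqP-> n3].
  have -> : (ord0 \in full_crit 0) = false by rewrite inE.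
  have wE t : word (ord0 : 'I_n) false (full_crit 0) t = (t < n) && (t %% 3 != 0).
    rewrite word_ord0 /dom /= muln0 addn0 subn0; case: ltnP => //= tn.
    by rewrite inZp_full_crit // addn0.
  by rewrite /occurs !wE; lia.
have -> : (ord0 \in full_crit 1) = true by rewrite inE.
(* The extra initial 0 turns 110110... into 011011...; the last letter, the second copy of edge 0,
   fits this pattern because [n] is not 2 modulo 3. *)
have wE t : word (ord0 : 'I_n) true (full_crit 1) t = (t < n.+2) && (t %% 3 != 0).
  rewrite word_ord0 /dom /= muln1 addn2 subn1; case: t => [|t] //=.
  case: ltnP => //= tn; rewrite !ltnS in tn; move: tn; rewrite leq_eqVlt => /orP[/eqP->|tn].
    by rewrite inZpn inE /=; lia.
  by rewrite inZp_full_crit // addn1.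
by rewrite /occurs !wE; lia.
Qed.

(** The subtracted terms count the absent edges: the multiples of 3 for [c = 0], the numbers
    congruent to 2 for [c = 1]. *)
Lemma card_full_crit c : c <= 1 ->
  #|full_crit c| = if c == 0 then n - (n + 2) %/ 3 else n - n %/ 3.
Proof.
move=> c1; rewrite -sum1_card big_mkcond /=.
under eq_bigr => i _ do rewrite inE.
have h N : \sum_(i < N) (if (i + c) %% 3 != 0 then 1 else 0) =
    if c == 0 then N - (N + 2) %/ 3 else N - N %/ 3.
  elim: N => [|N IH]; first by rewrite big_ord0; case: eqP.
  rewrite big_ord_recr /= IH; by case: c c1 {IH} => [|[|//]] _ /=; case: ifP; lia.
exact: h.
Qed.

Lemma full_crit_neq : full_crit 0 != full_crit 1.
Proof.
by apply/eqP => /setP/(_ ord0); rewrite !inE.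
Qed.

(** If the base edge lies in both sets or in neither, the two words agree by [avoiding_word_uniq].
    If it lies in just one, everything is covered and the sets are [full_crit 1] and [full_crit 0];
    then 3 divides [n] and both contain two thirds of the edges. *)
Lemma critical_same_card S T : pivot S = None -> pivot T = None ->
  covered S = covered T -> #|S| = #|T|.
Proof.
move=> pS pT cST; have bST := base_cover cST.
(* By symmetry, the base edge does not belong to [T] alone. *)
wlog : S T pS pT cST bST / (base S \in S) || (base T \notin T).
  move=> h; case: (boolP (base S \in S)) => [bS|bS]; first by apply: h => //; rewrite bS.
  case: (boolP (base T \in T)) => [bT|bT]; last by apply: h => //; rewrite bT orbT.
  by symmetry; apply: h => //; rewrite bT.
have [bS|bS] := boolP (base S \in S); have [bT|bT] := boolP (base T \in T) => // _; last first.
- have w0 := word0 S; have v0 := word0 T; rewrite -bST in bT.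
  move: pS pT => /pivotN pS /pivotN pT.
  have wE U t : base U = base S -> base S \notin U ->
      cword U t = (t < n) && (inZp (base S + t) \in U).
    by move=> bU nU; rewrite /cword bU (negPf nU) /word /dom /idx muln0 addn0 subn0.
  suff e : cword S =1 cword T.
    apply/eq_card => v.
    have [t tn ->] := inZp_offset v (base S).
    by have := e t; rewrite !wE // tn.
  apply: avoiding_word_uniq => // t; rewrite !wE // addnS.
  have [tn|tn] := ltnP t.+1 n.
    by rewrite (ltnW tn) /= -!cover_inZpS cST.
  (* At the last position the next letter is outside the word, in agreement with the absence of the
     edge [base S]; the last letter is then the covering of the vertex [base S]. *)
  have [tn'|//] := ltnP t n; rewrite !orbF /=.
  have te : inZp (base S + t).+1 = base S.
    by rewrite -addnS (_ : t.+1 = n) ?inZpDn ?valZpK //; apply/eqP; rewrite eqn_leq tn tn'.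
  have := cover_inZpS S (base S + t); have := cover_inZpS T (base S + t).
  by rewrite te (negPf bS) (negPf bT) !orbF cST => -> ->.
- have [cS _] := base_in bS; have cT : covered T = setT by rewrite -cST.
  have := full_crit_sub cS pS; have := full_crit_sub cT pT.
  rewrite (base_full cS) in bS; rewrite (base_full cT) in bT.
  case=> [[eT nT]|[eT _]]; last by move: bT; rewrite eT inE.
  case=> [[eS _]|[eS nS]]; first by move: bS; rewrite eS inE.
  by rewrite eS eT !card_full_crit //=; lia.
have w0 := word0 S; have v0 := word0 T.
have [cS bS0] := base_in bS; have [cT bT0] := base_in bT.
move: pS pT => /pivotN pS /pivotN pT.
rewrite bS0 in bS; rewrite bT0 in bT.
have wE U t : base U = ord0 -> ord0 \in U ->
    cword U t.+1 = (t <= n) && (inZp t \in U).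
  by move=> bU U0; rewrite /cword bU U0 word_ord0 /dom muln1 addn2 subn1 /= !ltnS.
suff e : cword S =1 cword T.
  by apply/eq_card => v; have := e v.+1; rewrite !wE // valZpK (ltnW (ltn_ord v)).
apply: avoiding_word_uniq => // t.
case: t => [|t]; first by rewrite !wE // inZp0 bS bT !orbT.
rewrite !wE //; have [tn|tn] := ltnP t n.
  by rewrite (ltnW tn) /= -!cover_inZpS cST.
have [tn'|//] := leqP t n; have -> : t = n by apply/eqP; rewrite eqn_leq tn' tn.
by rewrite inZpn bS bT.
Qed.

(** * Critical sets leaving a vertex uncovered *)

Local Notation suc v := (inZp (nat_of_ord v).+1 : 'I_n).
Local Notation pre v := (inZp (nat_of_ord v + m) : 'I_n).

Lemma preK v : suc (pre v) = v.
Proof. by rewrite inZpS -addnS inZpDn valZpK. Qed.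

Lemma sucK v : pre (suc v) = v.
Proof. by rewrite inZpD addSnnS inZpDn valZpK. Qed.

Definition avoids S :=
  [forall v : 'I_n, (v \notin S) && (suc v \in S) ==> (suc (suc (suc v)) \notin S)].

(** The two edges at the uncovered vertex [base S] are absent, and a cyclic occurrence of 01x1
    running across this vertex would have one of its letters 1 there. So the starting point of the
    word no longer matters. *)
Lemma nonfull_crit S : covered S != setT -> (pivot S == None) = avoids S.
Proof.
move=> nf; have := base_notin nf; rewrite inE negb_or => /andP[rS prS].
have wE : cword S =1 fun t => (t < n) && (inZp (base S + t) \in S).
  by move=> t; rewrite /cword (negPf rS) /word /dom /idx muln0 addn0 subn0.
apply/eqP/forallP => [/pivotN no v|av]; last first.
  apply/pivotN => p; rewrite /occurs !wE; apply/negP => /and3P[h0 /andP[_ h1] /andP[pn h3]].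
  have pn' : p < n := ltnW (ltnW (ltnW pn)).
  rewrite pn' /= in h0; have := av (inZp (base S + p)).
  by rewrite !addnS in h1 h3; rewrite !(inZpS, inZpS2) h0 h1 h3.
have [t tn vE] := inZp_offset v (base S).
rewrite vE !(inZpS, inZpS2) -!addnS; apply/implyP => /andP[h0 h1]; apply/negP => h3.
have t1 : t.+1 != n.
  by apply: contraTneq h1 => ->; rewrite inZpDn valZpK.
have t2 : t.+2 != n.
  by apply: contraTneq h1 => -[->].
have t3 : t.+3 != n.
  by apply: contraTneq h3 => ->; rewrite inZpDn valZpK.
have t3n : t.+3 < n.
  move: tn t1 t2 t3; rewrite leq_eqVlt => /orP[/eqP->|]; first by rewrite eqxx.
  rewrite leq_eqVlt => /orP[/eqP->|]; first by rewrite eqxx.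
  by rewrite leq_eqVlt => /orP[/eqP->|//]; rewrite eqxx.
have := no t; rewrite /occurs !wE h1 h3 t3n tn h0 /= andbT.
by rewrite ltnW // ltnW.
Qed.

Definition runs S := [set v in S | pre v \notin S].
Definition long_runs S := [set v in runs S | suc v \in S].
(** Inverse of taking [runs] and [long_runs]: each run is given by its first edge, and [T] lists the
    runs that get a second edge. *)
Definition of_runs R T := R :|: [set v : 'I_n | pre v \in T].
Definition spaced R :=
  [forall v : 'I_n, (v \in R) ==> (suc v \notin R) && (suc (suc v) \notin R)].

Lemma card_shift S : #|[set v : 'I_n | pre v \in S]| = #|S|.
Proof.
have inj : injective (fun v : 'I_n => suc v).
  by apply: (can_inj (g := fun v : 'I_n => pre v)); exact: sucK.
rewrite -[in RHS](card_imset S inj); apply: eq_card => v.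
rewrite inE; apply/idP/imsetP => [h|[u uS ->]]; first by exists (pre v); rewrite ?preK.
by rewrite sucK.
Qed.

(** Each run covers one more vertex than it has edges, and different runs cover disjoint sets of
    vertices. *)
Lemma card_cover S : #|covered S| = #|S| + #|runs S|.
Proof.
have -> : covered S = S :|: [set v : 'I_n | pre v \in S] by apply/setP => v; rewrite !inE.
have -> : runs S = S :\: [set v : 'I_n | pre v \in S].
  by apply/setP => v; rewrite !inE andbC.
by rewrite cardsU card_shift cardsD addnBA // subset_leq_card // subsetIl.
Qed.

Lemma nonfull_111 S v : covered S != setT -> avoids S ->
  v \in S -> suc v \in S -> suc (suc v) \notin S.
Proof.
move=> nf /forallP av vS sS; apply/negP => ssS; case/negP: nf; apply/eqP.
(* Modulo [n], [v + m * t] is [v - t]: as 0111 is forbidden, the block 111 propagates backwards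
   around the whole cycle. *)
suff h t : [/\ inZp (v + m * t) \in S, inZp (v + m * t).+1 \in S & inZp (v + m * t).+2 \in S].
  apply/setP => u; rewrite [RHS]inE.
  have [t ut] : exists t, u = inZp (v + m * t).
    (* Since [m] is -1 modulo [n], this witness is [v - u]. *)
    exists (m * u + v); rewrite -[LHS]valZpK; apply/inZp_inj_mod.
    have -> : v + m * (m * u + v) = u + (v + (m - 1) * u) * n.
      by rewrite mulnBl mul1n; nia.
    by rewrite addnC modnMDl.
  by rewrite inE ut; have [->] := h t.
elim: t => [|t [h0 h1 h2]].
  by rewrite muln0 addn0 valZpK vS sS -inZpS ssS.
have e : inZp (v + m * t.+1).+1 = inZp (v + m * t) :> 'I_n.
  by rewrite mulnS addnCA addnC -addnS inZpDn.
have e1 : inZp (v + m * t.+1).+2 = inZp (v + m * t).+1 :> 'I_n.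
  by rewrite -inZpS e inZpS.
split; rewrite ?e ?e1 //; apply/negPn/negP => no.
have := av (inZp (v + m * t.+1)); rewrite no !(inZpS, inZpS2) e h0 /=.
by rewrite -inZpS e1 inZpS h2.
Qed.

(** The absent edge before a run, the first edge of the run and an edge two places after that would
    form 01x1. *)
Lemma runs_spaced S : covered S != setT -> avoids S -> spaced (runs S).
Proof.
move=> nf av; apply/forallP => v; apply/implyP; rewrite !inE !sucK => /andP[vS pS].
rewrite vS /= andbF /= negb_and; apply/orP; left.
by have /forallP/(_ (pre v)) := av; rewrite !preK pS vS.
Qed.

Lemma of_runsK S : covered S != setT -> avoids S ->
  of_runs (runs S) (long_runs S) = S.
Proof.
move=> nf av; apply/setP => v; rewrite !inE preK.
have [vS|] := boolP (v \in S); last by rewrite !andbF.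
have [pS|//] := boolP (pre v \in S); rewrite andbF orFb andTb andbT.
apply/negP => ppS; have := nonfull_111 nf av ppS.
by rewrite !preK pS vS => /(_ isT).
Qed.

Lemma spacedP R v : spaced R -> v \in R ->
  [/\ suc v \notin R, suc (suc v) \notin R, pre v \notin R & pre (pre v) \notin R].
Proof.
move=> /forallP sp vR; have := sp v; rewrite vR => /andP[h1 h2]; split=> //.
  by apply/negP => h; have := sp (pre v); rewrite h preK vR.
by apply/negP => h; have := sp (pre (pre v)); rewrite h !preK vR andbF.
Qed.

Section OfRuns.

Variables R T : {set 'I_n}.
Hypotheses (spR : spaced R) (TR : T \subset R).

Lemma in_of_runs v : (v \in of_runs R T) = (v \in R) || (pre v \in T).
Proof. by rewrite !inE. Qed.

Lemma runs_of_runs : runs (of_runs R T) = R.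
Proof.
apply/setP => v; rewrite inE !in_of_runs.
have [vR|vR] := boolP (v \in R) => /=.
  have [_ _ h1 h2] := spacedP spR vR; rewrite (negPf h1) /=.
  by apply: contra h2 => /(subsetP TR).
by apply/negP => /andP[/(subsetP TR) h]; rewrite h.
Qed.

Lemma avoids_of_runs : avoids (of_runs R T).
Proof.
apply/forallP => v; apply/implyP; rewrite !in_of_runs !sucK negb_or.
move=> /andP[/andP[vR _]] /orP[sR|/(subsetP TR)]; last by rewrite (negPf vR).
have [h1 h2 _ _] := spacedP spR sR; rewrite (negPf h2) /=.
by apply: contra h1 => /(subsetP TR).
Qed.

Lemma long_runs_of_runs : long_runs (of_runs R T) = T.
Proof.
apply/setP => v; rewrite inE runs_of_runs in_of_runs sucK.
have [vR|vR] := boolP (v \in R) => /=; last first.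
  by symmetry; apply: contraNF vR => /(subsetP TR).
by have [h1 _ _ _] := spacedP spR vR; rewrite (negPf h1).
Qed.

Lemma card_of_runs : #|of_runs R T| = #|R| + #|T|.
Proof.
rewrite cardsU card_shift (_ : R :&: _ = set0) ?cards0 ?subn0 //.
apply/setP => v; rewrite !inE; apply/negP => /andP[vR /(subsetP TR) pR].
by have [_ _ h _] := spacedP spR vR; rewrite pR in h.
Qed.

End OfRuns.

Lemma card_long_runs S : covered S != setT -> avoids S ->
  #|S| = #|runs S| + #|long_runs S|.
Proof.
move=> nf av; rewrite -{1}(of_runsK nf av) card_of_runs ?runs_spaced //.
by apply/subsetP => v; rewrite inE => /andP[].
Qed.

Definition num_spaced r := #|[set R : {set 'I_n} | spaced R & #|R| == r]|.

(** By [card_cover] there are [j - i] runs, of one or two edges each, so [2 * i - j] of them are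
    long. A critical set amounts to a spaced set of run starts with a subset marking the long
    runs. *)
Lemma card_nonfull_crit i j : i <= j -> j <= 2 * i -> j < n ->
  #|[set S : {set 'I_n} | [&& pivot S == None, #|S| == i & #|covered S| == j]]| =
  num_spaced (j - i) * 'C(j - i, 2 * i - j).
Proof.
move=> ij ji jn.
have nonfull S : #|covered S| = j -> covered S != setT.
  by move=> cj; apply: contraTneq jn => cT; rewrite -cj cT cardsT card_ord ltnn.
rewrite -sum1_card (partition_big runs [pred R | spaced R & #|R| == j - i]) /=; last first.
  move=> S; rewrite inE => /and3P[pS /eqP Si /eqP Sj]; have nf := nonfull S Sj.
  rewrite runs_spaced -?nonfull_crit //=.
  by rewrite -Sj card_cover -Si addKn.
rewrite /num_spaced -sum1_card big_distrl /=.
apply: eq_big => [R|R /andP[spR /eqP Rr]]; first by rewrite inE.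
rewrite mul1n -Rr -cards_draws sum1_card.
rewrite -[RHS](card_in_imset (f := of_runs R)); last first.
  move=> T1 T2; rewrite !inE => /andP[T1R _] /andP[T2R _] e.
  by rewrite -(long_runs_of_runs spR T1R) e long_runs_of_runs.
apply: eq_card => S; rewrite [LHS]unfold_in /= inE; apply/idP/imsetP.
  move=> /andP[/and3P[pS /eqP Si /eqP Sj] /eqP RS]; have nf := nonfull S Sj.
  have av : avoids S by rewrite -nonfull_crit.
  exists (long_runs S); last by rewrite -RS of_runsK.
  rewrite inE -RS; apply/andP; split.
    by apply/subsetP => v; rewrite inE => /andP[].
  have := card_long_runs nf av; rewrite Si RS Rr => h; apply/eqP; move: ij ji (#|_|) h; clear; lia.
case=> T; rewrite inE => /andP[TR /eqP Tc] ->.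
have cS : #|of_runs R T| = i by rewrite card_of_runs // Rr Tc; lia.
have cC : #|covered (of_runs R T)| = j by rewrite card_cover cS runs_of_runs // Rr; lia.
by rewrite nonfull_crit ?nonfull // avoids_of_runs // cS cC runs_of_runs // !eqxx.
Qed.

End CyclicWords.

(** * Counting the critical sets *)

Section LinearGaps.

Variable N : nat.
Implicit Types (A B : {set 'I_N}) (l h r : nat).

Definition gapped A := [forall x in A, forall y in A, (x < y) ==> (x.+2 < y)].

Definition num_gapped l h r :=
  #|[set A : {set 'I_N} | [&& A \subset [set x : 'I_N | l <= x < h], gapped A & #|A| == r]]|.

Lemma gappedP A : reflect
  (forall x y : 'I_N, x \in A -> y \in A -> x < y -> x.+2 < y) (gapped A).
Proof.
apply: (iffP forall_inP) => [h x y xA yA|h x xA].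
  by have /forall_inP/(_ y yA)/implyP := h x xA.
by apply/forall_inP => y yA; apply/implyP; apply: h.
Qed.

Lemma gapped_subset A B : A \subset B -> gapped B -> gapped A.
Proof.
by move=> /subsetP AB /gappedP h; apply/gappedP => x y /AB xB /AB yB; apply: h.
Qed.

Lemma num_gapped0 l h : num_gapped l h 0 = 1.
Proof.
rewrite /num_gapped (_ : [set _ | _] = [set set0]) ?cards1 //.
apply/setP => A; rewrite !inE cards_eq0; case: eqP => [->|]; last by rewrite !andbF.
rewrite sub0set andbT /=; apply/gappedP => x y; by rewrite inE.
Qed.

Lemma num_gapped_empty l h r : h <= l -> num_gapped l h r.+1 = 0.
Proof.
move=> hl; apply/eqP; rewrite cards_eq0; apply/eqP/setP => A; rewrite !inE.
apply/negP => /and3P[/subsetP sub _ cA].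
have [x xA] : exists x, x \in A by apply/set0Pn; rewrite -card_gt0 (eqP cA).
by have := sub x xA; rewrite inE; lia.
Qed.

Lemma num_gappedS l h r : l <= h < N ->
  num_gapped l h.+1 r.+1 = num_gapped l h r.+1 + num_gapped l h.-2 r.
Proof.
move=> /andP[lh hN]; pose e := Ordinal hN.
rewrite {1}/num_gapped -(cardsID [set A : {set 'I_N} | e \in A]) addnC; congr (_ + _).
  apply: eq_card => A; rewrite !inE; have [eA|eA] /= := boolP (e \in A).
    symmetry; apply/negP => /andP[/subsetP sub _].
    by have := sub e eA; rewrite inE /= ltnn andbF.
  congr (_ && _); apply/subsetP/subsetP => sub x xA.
    have := sub x xA; rewrite !inE => /andP[-> /=]; rewrite ltnS leq_eqVlt.
    case/orP => // /eqP xh; suff xe : x = e by rewrite -xe xA in eA.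
    exact: val_inj.
  by have := sub x xA; rewrite !inE => /andP[-> /= /leqW].
rewrite /num_gapped -[RHS](card_in_imset (f := fun A => e |: A)); last first.
  have eN A : A \subset [set x : 'I_N | l <= x < h.-2] -> e \notin A.
    by move=> /subsetP sub; apply/negP => /sub; rewrite inE /=; lia.
  move=> A B; rewrite !inE => /andP[/eN eA _] /andP[/eN eB _] eq.
  by rewrite -(setU1K eA) eq setU1K.
apply: eq_card => A; rewrite !inE; apply/andP/imsetP.
  case=> /and3P[/subsetP sub gA cA] eA; exists (A :\ e); last by rewrite setD1K.
  rewrite inE (gapped_subset _ gA) ?subsetDl //.
  move: cA; rewrite (cardsD1 e) eA eqSS => -> /=; rewrite andbT.
  apply/subsetP => x; rewrite !inE => /andP[xe xA]; have := sub x xA; rewrite inE.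
  have := gappedP _ gA x e xA eA; rewrite /=.
  have : (x : nat) != h by apply: contraNneq xe => xh; apply/eqP/val_inj.
  by lia.
case=> B; rewrite inE => /and3P[/subsetP sub /gappedP gB cB] ->.
have eB : e \notin B by apply/negP => /sub; rewrite inE /=; lia.
split; last by rewrite setU11.
rewrite cardsU1 eB (eqP cB) eqxx andbT; apply/andP; split.
  apply/subsetP => x; rewrite !inE => /orP[/eqP->|/sub]; rewrite ?inE /=; lia.
apply/gappedP => x y; rewrite !inE => /orP[/eqP->|xB] /orP[/eqP->|yB] /=.
- by rewrite ltnn.
- by have := sub y yB; rewrite inE; lia.
- by have := sub x xB; rewrite inE; lia.
- exact: gB.
Qed.

Lemma num_gappedE l h r : h <= N -> num_gapped l h r = 'C(h - l + 2 - 2 * r, r).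
Proof.
elim: h {-2}h (leqnn h) r => [|b IH] h hb r hN.
  case: r => [|r]; first by rewrite num_gapped0 bin0.
  by rewrite num_gapped_empty ?bin_small //; lia.
case: r => [|r]; first by rewrite num_gapped0 bin0.
have [hl|lh] := leqP h l.
  by rewrite num_gapped_empty ?bin_small //; lia.
case: h lh hb hN => [//|h] lh hb hN; rewrite ltnS in lh.
rewrite num_gappedS ?lh // !IH; [|lia..].
have -> : h.+1 - l + 2 - 2 * r.+1 = (h - l).+1 - 2 * r by lia.
have -> : h - l + 2 - 2 * r.+1 = (h - l) - 2 * r by lia.
(* In the first case [r] is positive and the truncated subtractions make every term 0. *)
have [lt|ge] := ltnP (h - l) (2 * r).
  by case: r lt => [|r] lt; rewrite ?bin_small //; lia.
rewrite subSn // binS; congr (_ + _).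
have [hl2|hl2] := leqP 2 (h - l); first by congr 'C(_, _); lia.
by rewrite (_ : r = 0) ?bin0 //; lia.
Qed.

End LinearGaps.

Section CyclicGaps.

Variable m : nat.
Hypothesis m_ge2 : 2 <= m.
Local Notation n := m.+1.
Implicit Types (R A B : {set 'I_n}) (r : nat).

(** The second inequality measures the distance across the seam between [m] and 0. *)
Lemma spaced_iff R : spaced R <->
  (forall x y : 'I_n, x \in R -> y \in R -> x < y -> x.+2 < y /\ y.+2 < x + n).
Proof.
have inZpE (x : 'I_n) t : t < n.*2 -> inZp t = x -> t = x \/ t = x + n.
  move=> tn /(congr1 val) /= tx; have [lt|ge] := ltnP t n.
    by left; rewrite -tx modn_small.
  right; suff e : t %% n = t - n by rewrite -tx e subnK.
  by rewrite -{1}(subnK ge) modnDr modn_small // ltn_subLR // addnn.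
split=> [sp x y xR yR xy|h].
  have [xs xss _ _] := spacedP sp xR; have [ys yss _ _] := spacedP sp yR.
  rewrite inZpS in xss; rewrite inZpS in yss.
  have ne (t : nat) (u v : 'I_n) : u \in R -> inZp t \notin R -> t %% n = u -> False.
    by move=> uR tR tu; case/negP: tR; rewrite (_ : inZp t = u) //; apply: val_inj.
  have xn := ltn_ord x; have yn := ltn_ord y.
  have y1 : (y : nat) != x.+1.
    by apply/eqP => e; apply: (ne x.+1 y y) => //; rewrite modn_small -?e.
  have y2 : (y : nat) != x.+2.
    by apply/eqP => e; apply: (ne x.+2 y y) => //; rewrite modn_small -?e.
  have x1 : y.+1 != x + n.
    by apply/eqP => e; apply: (ne y.+1 x x) => //; rewrite e modnDr modn_small.
  have x2 : y.+2 != x + n.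
    by apply/eqP => e; apply: (ne y.+2 x x) => //; rewrite e modnDr modn_small.
  by split; lia.
apply/forallP => v; apply/implyP => vR; have vn := ltn_ord v.
apply/andP; split; apply/negP => sR.
  have [] := inZpE (inZp v.+1) v.+1 _ erefl => [|e|e]; first by lia.
    by have [] := h _ _ vR sR; rewrite -?e; lia.
  by have [] := h _ _ sR vR; lia.
rewrite inZpS in sR.
have [] := inZpE (inZp v.+2) v.+2 _ erefl => [|e|e]; first by lia.
  by have [] := h _ _ vR sR; rewrite -?e; lia.
by have [] := h _ _ sR vR; lia.
Qed.

Lemma num_spaced0 : num_spaced m 0 = 1.
Proof.
rewrite /num_spaced (_ : [set _ | _] = [set set0]) ?cards1 //.
apply/setP => A; rewrite !inE cards_eq0; case: eqP => [->|]; last by rewrite andbF.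
by rewrite andbT; apply/forallP => x; rewrite inE.
Qed.

(* A spaced set contains at most one of 0 and 1. *)
Lemma num_spacedS r : num_spaced m r.+1 =
  num_gapped n 2 n r.+1 + (num_gapped n 3 (n - 2) r + num_gapped n 4 (n - 1) r).
Proof.
have o1 : 1 < n by lia.
pose e0 : 'I_n := ord0; pose e1 := Ordinal o1.
(* Once [e] is chosen, the other elements form a gapped set in the interval from [l] to [h], which
   consists of the positions at cyclic distance at least 3 from [e]. *)
have with_elt (e : 'I_n) l h : (forall x : 'I_n, l <= x < h ->
      [/\ e.+2 < x & x.+2 < e + n]) ->
    (forall R (x : 'I_n), spaced R -> e \in R -> x \in R -> x != e -> l <= x < h) ->
    #|[set R : {set 'I_n} | [&& spaced R, #|R| == r.+1 & e \in R]]| = num_gapped n l h r.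
  move=> hl hR; rewrite /num_gapped -[RHS](card_in_imset (f := fun A => e |: A)); last first.
    have eN A : A \subset [set x : 'I_n | l <= x < h] -> e \notin A.
      by move=> /subsetP sub; apply/negP => /sub; rewrite inE => /hl; lia.
    move=> A B; rewrite !inE => /andP[/eN eA _] /andP[/eN eB _] eq.
    by rewrite -(setU1K eA) eq setU1K.
  apply: eq_card => A; rewrite inE; apply/idP/imsetP.
    case/and3P => spA cA eA; exists (A :\ e); last by rewrite setD1K.
    rewrite inE; move: cA; rewrite (cardsD1 e) eA eqSS => -> /=; rewrite andbT.
    apply/andP; split.
      by apply/subsetP => x; rewrite !inE => /andP[xe xA]; apply: (hR A).
    apply/gappedP => x y; rewrite !inE => /andP[_ xA] /andP[_ yA] xy.
    by have [] := (spaced_iff A).1 spA x y xA yA xy.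
  case=> B; rewrite inE => /and3P[/subsetP sub /gappedP gB cB] ->.
  have eB : e \notin B by apply/negP => /sub; rewrite inE => /hl; lia.
  rewrite cardsU1 eB (eqP cB) eqxx setU11 !andbT; apply/spaced_iff => x y.
  rewrite !inE => /orP[/eqP->|xB] /orP[/eqP->|yB] xy; first by rewrite ltnn in xy.
  - by have := sub y yB; rewrite inE => /hl[].
  - by have := sub x xB; rewrite inE => /hl; lia.
  split; first exact: gB.
  have := sub x xB; have := sub y yB; rewrite !inE => /hl[_ h1] /hl[h2 _].
  by lia.
pose X := [set R : {set 'I_n} | spaced R & #|R| == r.+1].
pose X0 := [set R : {set 'I_n} | e0 \in R]; pose X1 := [set R : {set 'I_n} | e1 \in R].
have in3 : #|X :&: X0| = num_gapped n 3 (n - 2) r.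
  rewrite -(@with_elt e0 3 (n - 2)).
  - by apply: eq_card => R; rewrite !inE andbA.
  - by move=> x /=; lia.
  move=> R x /spaced_iff sp eR xR xe.
  have x0 : 0 < x by rewrite lt0n; apply: contraNneq xe => x0; apply/eqP/val_inj.
  by have [] := sp e0 x eR xR x0; rewrite /=; lia.
have in4 : #|(X :\: X0) :&: X1| = num_gapped n 4 (n - 1) r.
  rewrite -(@with_elt e1 4 (n - 1)).
  - apply: eq_card => R; rewrite !inE.
    apply/andP/and3P => [[/andP[_ /andP[-> ->]] ->] //|[spR cR e1R]].
    split=> //; rewrite spR cR !andbT; apply/negP => e0R.
    by have [] := (spaced_iff R).1 spR e0 e1 e0R e1R isT.
  - by move=> x /=; lia.
  move=> R x /spaced_iff sp eR xR xe.
  have [x1|x1] := ltnP 1 x; first by have [] := sp e1 x eR xR x1; rewrite /=; lia.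
  have x0 : (x : nat) = 0.
    apply/eqP; rewrite -leqn0 -ltnS ltn_neqAle x1 andbT.
    by apply: contraNneq xe => x0; apply/eqP/val_inj.
  by have := sp x e1 xR eR; rewrite x0 /= => /(_ isT)[].
have in2 : #|X :\: X0 :\: X1| = num_gapped n 2 n r.+1.
  apply: eq_card => R; rewrite !inE.
  apply/and3P/and3P => [[e1R e0R /andP[/spaced_iff sp cR]]|[/subsetP sub /gappedP gR cR]].
    split=> //; last by apply/gappedP => x y xR yR xy; have [] := sp x y xR yR xy.
    apply/subsetP => x xR; rewrite inE ltn_ord andbT.
    have x0 : (x : nat) != 0.
      by apply: contraNneq e0R => x0; rewrite (_ : e0 = x) //; apply/val_inj.
    have x1 : (x : nat) != 1.
      by apply: contraNneq e1R => x1; rewrite (_ : e1 = x) //; apply/val_inj.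
    by lia.
  split; [by apply/negP => /sub; rewrite inE..|rewrite cR andbT].
  apply/spaced_iff => x y xR yR xy; split; first exact: gR.
  have := sub x xR; have := sub y yR; rewrite !inE; lia.
by rewrite /num_spaced -/X -(cardsID X0 X) -(cardsID X1 (X :\: X0)) in3 in4 in2 addnA addnC.
Qed.

(** For [r > 0] and [a = n - 2 * r], [num_spacedS] gives ['C(a, r) + 2 * 'C(a.-1, r.-1)]; now use
    [a * 'C(a.-1, r.-1) = r * 'C(a, r)] and [a + 2 * r = n]. *)
Lemma num_spacedE r : 2 * r < n -> (n - 2 * r) * num_spaced m r = n * 'C(n - 2 * r, r).
Proof.
case: r => [|r] rn; first by rewrite num_spaced0 bin0 muln0 subn0.
rewrite num_spacedS !num_gappedE ?leq_subr //.
have -> : n - 2 + 2 - 2 * r.+1 = n - 2 * r.+1 by lia.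
pose a := n - 2 * r.+1; rewrite -/a.
(* For [r = 0] truncation can make the upper indices differ, but both coefficients are 1. *)
have e3 : 'C(n - 2 - 3 + 2 - 2 * r, r) = 'C(a.-1, r).
  have [r0|r0] := posnP r; first by rewrite r0 !bin0.
  by congr 'C(_, _); rewrite /a; lia.
have e4 : 'C(n - 1 - 4 + 2 - 2 * r, r) = 'C(a.-1, r).
  have [r0|r0] := posnP r; first by rewrite r0 !bin0.
  by congr 'C(_, _); rewrite /a; lia.
rewrite e3 e4 addnn -mul2n mulnDr mulnCA mul_bin_diag mulnA -mulnDl.
by congr (_ * _); rewrite /a; lia.
Qed.

Lemma num_spaced_eq0 r : n <= 2 * r -> num_spaced m r = 0.
Proof.
case: r => [//|r] nr; rewrite num_spacedS !num_gappedE ?leq_subr //.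
by rewrite !bin_small //; lia.
Qed.

End CyclicGaps.

Import Order.TTheory GRing.Theory Num.Theory.
Local Open Scope ring_scope.

(** * Independence of the resolution *)

Section GradedMatrices.

Variables (k : fieldType) (m : nat).
Local Notation R := {mpoly k[m]}.

(** Matrices of degree 0 maps between graded free modules whose basis degrees are [p] and [q]. *)
Definition homog_mx (a b : nat) (p : 'I_a -> nat) (q : 'I_b -> nat)
    (M : 'M[R]_(a, b)) : Prop :=
  forall i j u, u \in msupp (M i j) -> (mdeg u + q j)%N = p i.

Lemma homog_mxP a b (p : 'I_a -> nat) (q : 'I_b -> nat) M :
  homog_mx p q M <->
  forall i j u, (mdeg u + q j)%N != p i -> (M i j)@_u = 0.
Proof.
split=> h i j u; last first.
  by move=> uM; apply: contraTeq uM => /h; rewrite -mcoeff_eq0 => ->.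
by move=> ne; apply/eqP; rewrite mcoeff_eq0; apply: contra ne => /h/eqP.
Qed.

Lemma homog_mxB a b (p : 'I_a -> nat) (q : 'I_b -> nat) M N :
  homog_mx p q M -> homog_mx p q N -> homog_mx p q (M - N).
Proof.
move=> /homog_mxP hM /homog_mxP hN; apply/homog_mxP => i j u ne.
by rewrite !mxE mcoeffB hM // hN // subr0.
Qed.

Lemma homog_mxM a b c (p : 'I_a -> nat) (q : 'I_b -> nat) (r : 'I_c -> nat)
    (M : 'M_(a, b)) (N : 'M_(b, c)) :
  homog_mx p q M -> homog_mx q r N -> homog_mx p r (M *m N).
Proof.
move=> hM hN i j u; rewrite mxE => /msupp_sum_le /flatten_mapP[l _].
move=> /msuppM_le /allpairsP[[u1 u2] /= [/hM e1 /hN e2 ->]].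
by rewrite mdegD -e1 -e2 addnA.
Qed.

Definition hpart (P : pred 'X_{1..m}) (p : R) : R :=
  \sum_(u <- msupp p | P u) p@_u *: 'X_[u].

Lemma mcoeff_hpart P p u : (hpart P p)@_u = if P u then p@_u else 0.
Proof.
rewrite /hpart raddf_sum /= big_mkcond /=.
under eq_bigr => v _ do rewrite mcoeffZ mcoeffX.
have [up|up] := boolP (u \in msupp p); last first.
  rewrite (memN_msupp_eq0 up) if_same big_seq big1 // => v vp.
  by case: eqP vp up => [-> ->//|]; rewrite mulr0 if_same.
rewrite (bigD1_seq u) ?msupp_uniq //= eqxx mulr1 big1 ?addr0 // => v /negPf->.
by rewrite mulr0 if_same.
Qed.

(* The part of W of the right degree also solves M = W N: the rest of W only
   contributes monomials of other degrees. *)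
Lemma homog_factor a b c (p : 'I_a -> nat) (q : 'I_b -> nat) (r : 'I_c -> nat)
    (M : 'M_(a, c)) (N : 'M_(b, c)) (W : 'M_(a, b)) :
  homog_mx p r M -> homog_mx q r N -> M = W *m N ->
  exists2 W', homog_mx p q W' & M = W' *m N.
Proof.
move=> hM hN eM.
pose P i j := [pred u : 'X_{1..m} | (mdeg u + q j)%N == p i].
exists (\matrix_(i, j) hpart (P i j) (W i j)).
  by apply/homog_mxP => i j u; rewrite !mxE mcoeff_hpart /= => /negPf->.
set W' := \matrix_(_, _) _.
have hW' : homog_mx p q W'.
  by apply/homog_mxP => i j u; rewrite !mxE mcoeff_hpart /= => /negPf->.
apply/eqP; rewrite -subr_eq0; apply/eqP/matrixP => i j; apply/mpolyP => u.
rewrite [in RHS]mxE mcoeff0; apply/eqP/negPn/negP => un0.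
have degu : (mdeg u + r j)%N = p i.
  by apply: (homog_mxB hM (homog_mxM hW' hN)); rewrite mcoeff_msupp.
move: un0; rewrite {1}eM -mulmxBl -mcoeff_msupp mxE.
move=> /msupp_sum_le /flatten_mapP[l _].
move=> /msuppM_le /allpairsP[[u1 u2] /= [h1 h2 eu]].
move: h1; rewrite mcoeff_msupp !mxE mcoeffB mcoeff_hpart /=.
rewrite -degu eu mdegD -addnA (hN _ _ _ h2) eqxx subrr eqxx //.
Qed.

Lemma row_factor a b c (M : 'M[R]_(a, c)) (N : 'M[R]_(b, c)) :
  (forall i, exists w : 'rV_b, row i M = w *m N) -> exists W, M = W *m N.
Proof.
move=> /fin_all_exists[f fP]; exists (\matrix_i f i).
by apply/row_matrixP => i; rewrite fP row_mul rowK.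
Qed.

End GradedMatrices.

(** * Comparison of two graded free resolutions *)

Section Comparison.

Variables (k : fieldType) (m : nat).
Local Notation R := {mpoly k[m]}.
Variables (I : R -> Prop) (s : nat) (gens : 'cV[R]_s) (gens_deg : 'I_s -> nat).
Hypothesis gens_homog : homog_mx gens_deg (fun _ => 0%N) gens.
Hypothesis idealP : forall p, I p <-> exists c : 'rV_s, p = (c *m gens) 0 0.

Lemma ideal_rowP a (v : 'rV[R]_a) (N : 'cV[R]_a) :
  I ((v *m N) 0 0) <-> exists c : 'rV_s, v *m N = c *m gens.
Proof.
rewrite idealP; split=> [] [c e]; exists c; last by rewrite e.
by apply/matrixP => i j; rewrite !ord1.
Qed.

Lemma diff_homog_mx (F : graded_free_seq k m) i :
  homog_mx (gdeg F i.+1) (gdeg F i) (diff F i).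
Proof. by move=> a b u /diff_homog. Qed.

Lemma aug_homog_mx (F : graded_free_seq k m) :
  homog_mx (gdeg F 0) (fun _ => 0%N) (aug F).
Proof. by move=> a b u; rewrite ord1 addn0 => /aug_homog. Qed.

Section Lifting.

Variables (G : graded_free_seq k m) (resG : resolves G I).

(** The map to R / I is surjective only modulo the ideal, so the generators are stacked below
    [aug G], with their own degrees in [q], before [homog_factor] is applied. *)
Lemma lift_aug a (p : 'I_a -> nat) (A : 'cV[R]_a) :
  homog_mx p (fun _ => 0%N) A ->
  exists2 f, homog_mx p (gdeg G 0) f & exists c : 'M_(a, s), A - f *m aug G = c *m gens.
Proof.
move=> hA; have [surjG _ _] := resG.
pose N := col_mx (aug G) gens.
pose q j := match split j with inl a => gdeg G 0 a | inr b => gens_deg b end.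
have hN : homog_mx q (fun _ => 0%N) N.
  move=> i j u; rewrite mxE /q; case: (split i) => l.
    exact: aug_homog_mx.
  exact: gens_homog.
have [|W eW] := @row_factor _ _ _ _ _ A N.
  move=> i; have [v] := surjG (A i 0); rewrite idealP => -[c e].
  exists (row_mx v c); rewrite mul_row_col; apply/matrixP => i' j.
  by rewrite !ord1 !mxE; move: e; rewrite !mxE => <-; rewrite addrC subrK.
have [W' hW' ->] := homog_factor hA hN eW.
exists (lsubmx W').
  move=> i j u; rewrite mxE => /hW'; rewrite /q -[lshift _ _]/(unsplit (inl j)).
  by rewrite unsplitK.
exists (rsubmx W').
by rewrite -{1}[W']hsubmxK mul_row_col addrC addKr.
Qed.

Lemma factor_diff0 a (A : 'M[R]_(a, rk G 0)) :
  (exists c : 'M_(a, s), A *m aug G = c *m gens) -> exists W, A = W *m diff G 0.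
Proof.
move=> [c e]; apply: row_factor => i; have [_ exG _] := resG.
by apply/exG/ideal_rowP; exists (row i c); rewrite -!row_mul e.
Qed.

Lemma factor_diff a i (A : 'M[R]_(a, rk G i.+1)) :
  A *m diff G i = 0 -> exists W, A = W *m diff G i.+1.
Proof.
move=> e; apply: row_factor => j; have [_ _ exG] := resG.
by apply/exG; rewrite -row_mul e row0.
Qed.

Lemma diffK i : diff G i.+1 *m diff G i = 0.
Proof.
have [_ _ exG] := resG.
apply/row_matrixP => j; rewrite row_mul row0; apply/exG.
by exists (delta_mx 0 j); rewrite rowE.
Qed.

Lemma diff0_aug : exists c : 'M_(rk G 1, s), diff G 0 *m aug G = c *m gens.
Proof.
have [_ exG _] := resG.
apply: row_factor => j; rewrite row_mul; apply/ideal_rowP/exG.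
by exists (delta_mx 0 j); rewrite rowE.
Qed.

End Lifting.

Section ChainMap.

Variables F G : graded_free_seq k m.

(** The comparison map over the identity of R / I: each stage is chosen to lift the previous one,
    and [chain_mapP] shows that a lift exists. *)
Fixpoint chain_map i : 'M[R]_(rk F i, rk G i) :=
  match i with
  | 0 => epsilon (inhabits 0) (fun f => homog_mx (gdeg F 0) (gdeg G 0) f /\
           exists c : 'M_(rk F 0, s), aug F - f *m aug G = c *m gens)
  | i'.+1 => epsilon (inhabits 0) (fun f =>
           homog_mx (gdeg F i'.+1) (gdeg G i'.+1) f /\
           f *m diff G i' = diff F i' *m chain_map i')
  end.

Hypotheses (resF : resolves F I) (resG : resolves G I).

Lemma chain_map0P : homog_mx (gdeg F 0) (gdeg G 0) (chain_map 0) /\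
  exists c : 'M_(rk F 0, s), aug F - chain_map 0 *m aug G = c *m gens.
Proof.
apply: (epsilon_spec (inhabits (0 : 'M[R]_(rk F 0, rk G 0)))
  (fun f => homog_mx (gdeg F 0) (gdeg G 0) f /\ _)).
by have [f hf cf] := lift_aug resG (@aug_homog_mx F); exists f.
Qed.

Lemma chain_mapP i : homog_mx (gdeg F i) (gdeg G i) (chain_map i) /\
  chain_map i.+1 *m diff G i = diff F i *m chain_map i.
Proof.
have step j : homog_mx (gdeg F j) (gdeg G j) (chain_map j) ->
    (exists W, diff F j *m chain_map j = W *m diff G j) ->
    homog_mx (gdeg F j.+1) (gdeg G j.+1) (chain_map j.+1) /\
    chain_map j.+1 *m diff G j = diff F j *m chain_map j.
  move=> hj [W eW]; apply: (epsilon_spec (inhabits (0 : 'M[R]_(rk F j.+1, rk G j.+1)))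
    (fun f => homog_mx (gdeg F j.+1) (gdeg G j.+1) f /\ _)).
  have hd := homog_mxM (@diff_homog_mx F j) hj.
  have [W' hW' eW'] := homog_factor hd (@diff_homog_mx G j) eW.
  by exists W'.
elim: i => [|i [hi ei]].
  have [h0 [c e0]] := chain_map0P; split=> //; apply: (step 0 h0 _).2.
  apply: factor_diff0 => //; have [d ed] := diff0_aug resF.
  exists (d - diff F 0 *m c); rewrite mulmxBl -ed -!mulmxA -e0.
  by rewrite mulmxBr opprB addrC subrK.
have [|hS eS] := step i hi; first by exists (chain_map i.+1).
split=> //; apply: (step _ hS _).2; apply: factor_diff => //.
by rewrite -mulmxA eS mulmxA diffK // mul0mx.
Qed.

End ChainMap.

Section NullHomotopy.

Variables (F : graded_free_seq k m) (resF : resolves F I).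
Variable A : forall i, 'M[R]_(rk F i).
Hypothesis A_chain : forall i, A i.+1 *m diff F i = diff F i *m A i.
Hypothesis A_aug : exists c : 'M_(rk F 0, s), A 0 *m aug F = c *m gens.

(** A chain endomorphism inducing 0 on R / I is homotopic to 0; the homotopy is again built by
    successive lifting. *)
Fixpoint null_homotopy i : 'M[R]_(rk F i, rk F i.+1) :=
  match i with
  | 0 => epsilon (inhabits 0) (fun h => A 0 = h *m diff F 0)
  | i'.+1 => epsilon (inhabits 0) (fun h =>
      A i'.+1 - diff F i' *m null_homotopy i' = h *m diff F i'.+1)
  end.

Lemma null_homotopy0 : A 0 = null_homotopy 0 *m diff F 0.
Proof.
apply: (epsilon_spec (inhabits (0 : 'M[R]_(rk F 0, rk F 1)))
  (fun h => A 0 = h *m diff F 0)).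
exact: factor_diff0.
Qed.

Lemma null_homotopyS i : A i.+1 =
  null_homotopy i.+1 *m diff F i.+1 + diff F i *m null_homotopy i.
Proof.
apply/eqP; rewrite -subr_eq; apply/eqP.
have step j : (A j.+1 - diff F j *m null_homotopy j) *m diff F j = 0 ->
    A j.+1 - diff F j *m null_homotopy j = null_homotopy j.+1 *m diff F j.+1.
  move=> e; apply: (epsilon_spec (inhabits (0 : 'M[R]_(rk F j.+1, rk F j.+2)))
    (fun h => _ = h *m diff F j.+1)).
  exact: factor_diff.
(* The element to be lifted is killed by the differential, by the homotopy identity one stage
   lower. *)
apply: (step); elim: i => [|i IH].
  by rewrite mulmxBl A_chain -mulmxA -null_homotopy0 subrr.
rewrite mulmxBl A_chain -mulmxA -(step i IH) mulmxBr.
by rewrite [_ *m (_ *m null_homotopy i)]mulmxA diffK // mul0mx subr0 subrr.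
Qed.

End NullHomotopy.

Section ResidueField.

Variables F G : graded_free_seq k m.

Definition residue a b (M : 'M[R]_(a, b)) : 'M[k]_(a, b) :=
  map_mx (mcoeff 0%MM) M.

Lemma residueM a b c (M : 'M[R]_(a, b)) (N : 'M[R]_(b, c)) :
  residue (M *m N) = residue M *m residue N.
Proof. exact: map_mxM. Qed.

Lemma residueD a b (M N : 'M[R]_(a, b)) :
  residue (M + N) = residue M + residue N.
Proof. exact: map_mxD. Qed.

Lemma residueB a b (M N : 'M[R]_(a, b)) :
  residue (M - N) = residue M - residue N.
Proof. exact: map_mxB. Qed.

Lemma residue1 a : residue (1%:M : 'M[R]_a) = 1%:M.
Proof. exact: map_mx1. Qed.

Lemma residue0 a b : residue (0 : 'M[R]_(a, b)) = 0.
Proof. exact: map_mx0. Qed.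

(** A constant coefficient can be non-zero only between basis vectors of equal degree. *)
Lemma tpart_residue i i' j
    (M : 'M[R]_(rk F i, rk G i')) :
  homog_mx (gdeg F i) (gdeg G i') M ->
  tpart F i j *m residue M = residue M *m tpart G i' j.
Proof.
move=> /homog_mxP hM; rewrite mul_diag_mx mul_mx_diag.
apply/matrixP => a b; rewrite !mxE.
have [<-|ne] := eqVneq (gdeg G i' b) (gdeg F i a); first by rewrite mulrC.
by rewrite hM ?mulr0 ?mul0r // mdeg0.
Qed.

Lemma tpart_id (E : graded_free_seq k m) i j a (x : 'M_(a, rk E i)) :
  (x <= tpart E i j)%MS -> x *m tpart E i j = x.
Proof.
move=> /submxP[y ->]; rewrite -mulmxA; congr (_ *m _).
rewrite mul_diag_mx; apply/matrixP => b c; rewrite !mxE.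
by case: (b =P c) => [->|_]; case: eqP; rewrite ?mulr1n ?mulr0n ?mulr1 ?mulr0 ?mul0r.
Qed.

End ResidueField.

Section TorInjection.

Variables F G : graded_free_seq k m.
Hypotheses (resF : resolves F I) (resG : resolves G I).

Lemma tdiffE (E : graded_free_seq k m) i : tdiff E i = residue (diff E i).
Proof. by []. Qed.

Lemma tdiffK (E : graded_free_seq k m) i :
  resolves E I -> tdiff E i.+1 *m tdiff E i = 0.
Proof. by move=> resE; rewrite !tdiffE -residueM (diffK resE) residue0. Qed.

Lemma tboundaries_tcycles i j : (tboundaries G i j <= tcycles G i j)%MS.
Proof.
have sub : (tboundaries G i j <= tpart G i j)%MS.
  rewrite /tboundaries tdiffE tpart_residue ?submxMl //.
  exact: diff_homog_mx.
case: i sub => [//|i] sub; rewrite sub_capmx sub; apply/sub_kermxP.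
by rewrite -mulmxA tdiffK // mulmx0.
Qed.

Lemma tcycles_tpart (E : graded_free_seq k m) i j :
  (tcycles E i j <= tpart E i j)%MS.
Proof. by case: i => [|i] /=; rewrite ?capmxSl. Qed.

End TorInjection.

Section Maps.
Variables F G : graded_free_seq k m.
Hypotheses (resF : resolves F I) (resG : resolves G I).
Local Notation f i := (residue (chain_map F G i)).

Lemma tpart_chain_map i j : tpart F i j *m f i = f i *m tpart G i j.
Proof. by apply: tpart_residue; have [] := chain_mapP resF resG i. Qed.

Lemma tdiff_chain_map i : f i.+1 *m tdiff G i = tdiff F i *m f i.
Proof. by rewrite !tdiffE -!residueM (chain_mapP resF resG i).2. Qed.

Lemma tcycles_chain_map i j : (tcycles F i j *m f i <= tcycles G i j)%MS.
Proof.
have sub : (tcycles F i j *m f i <= tpart G i j)%MS.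
  by rewrite (submx_trans (submxMr _ (tcycles_tpart _ _ _))) // tpart_chain_map submxMl.
case: i sub => [//|i] sub; rewrite sub_capmx sub; apply/sub_kermxP.
rewrite -mulmxA tdiff_chain_map mulmxA (_ : _ *m tdiff F i = 0) ?mul0mx //.
by apply/sub_kermxP; rewrite capmxSr.
Qed.

Lemma tboundaries_chain_map i j :
  (tboundaries F i j *m f i <= tboundaries G i j)%MS.
Proof.
rewrite /tboundaries -mulmxA -tdiff_chain_map mulmxA tpart_chain_map -mulmxA.
exact: submxMl.
Qed.

End Maps.

Section Injection.
Variables F G : graded_free_seq k m.
Hypotheses (resF : resolves F I) (resG : resolves G I).
Local Notation f i := (residue (chain_map F G i)).
Local Notation g i := (residue (chain_map G F i)).

(** The composite of the two comparison maps minus the identity induces 0 on R / I, hence is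
    null-homotopic; on cycles only the boundary term of the homotopy survives. *)
Lemma chain_map_homotopy i j a (z : 'M_(a, rk F i)) :
  (z <= tcycles F i j)%MS -> (z *m (f i *m g i - 1%:M) <= tboundaries F i j)%MS.
Proof.
move=> hz.
pose A l := chain_map F G l *m chain_map G F l - 1%:M : 'M_(rk F l).
have A_chain l : A l.+1 *m diff F l = diff F l *m A l.
  rewrite mulmxBl mulmxBr mulmx1 mul1mx -mulmxA (chain_mapP resG resF l).2.
  by rewrite !mulmxA (chain_mapP resF resG l).2.
have A_aug : exists c : 'M_(rk F 0, s), A 0 *m aug F = c *m gens.
  have [_ [c ec]] := chain_map0P F resG; have [_ [d ed]] := chain_map0P G resF.
  exists (- c - chain_map F G 0 *m d).
  rewrite !mulmxBl mul1mx mulNmx -ec -!mulmxA -ed mulmxBr opprB.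
  by rewrite opprB [RHS]addrC addrA subrK.
have eA : residue (A i) = f i *m g i - 1%:M.
  by rewrite residueB residueM residue1.
have [h eh] : exists h, z *m residue (A i) = h *m tdiff F i.
  case: i {eA} z hz => [|i] z hz.
    exists (z *m residue (null_homotopy A 0)).
    by rewrite (null_homotopy0 resF A_aug) residueM mulmxA.
  exists (z *m residue (null_homotopy A i.+1)).
  rewrite (null_homotopyS resF A_chain A_aug) residueD !residueM mulmxDr.
  rewrite !mulmxA [z *m residue (diff F i)](_ : _ = 0) ?mul0mx ?addr0 //.
  by apply/sub_kermxP; rewrite (submx_trans hz) // capmxSr.
have sub : (z *m residue (A i) <= tpart F i j)%MS.
  have zt := submx_trans hz (tcycles_tpart _ _ _).
  rewrite eA mulmxBr mulmx1 addmx_sub ?eqmx_opp // mulmxA.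
  rewrite (submx_trans (submxMr _ (submxMr _ zt))) //.
  by rewrite tpart_chain_map // -mulmxA tpart_chain_map // mulmxA submxMl.
(* The homotopy was not chosen homogeneous; the projection [tpart] retains its part in degree
   [j]. *)
rewrite -eA -(tpart_id sub) eh -mulmxA -tpart_residue; last exact: diff_homog_mx.
by rewrite submxMl.
Qed.

(** The map induced on homology is injective because the comparison map in the other direction
    undoes it up to boundaries; [phi] is this map followed by the quotient by the boundaries of
    [G]. *)
Lemma tor_dim_le i j : (tor_dim F i j <= tor_dim G i j)%N.
Proof.
rewrite /tor_dim; set Z := tcycles F i j; set B := tboundaries F i j.
set Z' := tcycles G i j; set B' := tboundaries G i j.
pose phi := f i *m cokermx B'.
have kerle : (Z :&: kermx phi <= B)%MS.
  set K := (_ :&: _)%MS.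
  have KZ : (K <= Z)%MS by rewrite capmxSl.
  have KB : (K *m f i <= B')%MS.
    by rewrite submxE -mulmxA; apply/eqP/sub_kermxP; rewrite capmxSr.
  have e : K = K *m f i *m g i - K *m (f i *m g i - 1%:M).
    by rewrite mulmxBr mulmx1 mulmxA subKr.
  rewrite e addmx_sub ?eqmx_opp ?chain_map_homotopy //.
  rewrite (submx_trans (submxMr _ KB)) //; exact: tboundaries_chain_map.
have le1 : (\rank Z - \rank B <= \rank (Z *m phi))%N.
  by rewrite -(mxrank_mul_ker Z phi) leq_subLR addnC leq_add2r mxrankS.
apply: leq_trans le1 _.
have le2 : (\rank (Z *m phi) <= \rank (Z' *m cokermx B'))%N.
  by rewrite mxrankS // mulmxA submxMr // tcycles_chain_map.
apply: leq_trans le2 _.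
rewrite -(mxrank_mul_ker Z' (cokermx B')) -addnBA ?leq_addr //.
  rewrite mxrankS // sub_capmx tboundaries_tcycles //.
  by apply/sub_kermxP; rewrite mulmx_coker.
Qed.

End Injection.

(** The previous inequality holds in both directions, so the resolution picked by [epsilon] does not
    matter. *)
Lemma betti_tor_dim (F : graded_free_seq k m) i j :
  resolves F I -> betti I i j = tor_dim F i j.
Proof.
move=> resF.
have [G [resG <-]] : exists G, resolves G I /\ tor_dim G i j = betti I i j.
  apply: (epsilon_spec (inhabits 0%N)
    (fun b => exists G, resolves G I /\ tor_dim G i j = b)).
  by exists (tor_dim F i j), F.
by apply/anti_leq; rewrite !tor_dim_le.
Qed.

End Comparison.

(** * The Taylor resolution *)

Section SquarefreeMonomials.

Variables (k : fieldType) (V : finType).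
Local Notation R := {mpoly k[#|V|]}.
Implicit Types (A B : {set V}).

Definition mnm_set A : 'X_{1..#|V|} := [multinom nat_of_bool (enum_val i \in A) | i < #|V|].

Lemma mdeg_mnm_set A : mdeg (mnm_set A) = #|A|.
Proof.
rewrite mdegE -sum1_card [RHS]big_mkcond /=.
rewrite (reindex (@enum_val V predT)) /=; last first.
  by exists enum_rank => x _; rewrite ?enum_rankK ?enum_valK.
by apply: eq_bigr => i _; rewrite mnmE; case: (_ \in A).
Qed.

Lemma mnm_set_le A B : (mnm_set A <= mnm_set B)%MM = (A \subset B).
Proof.
apply/mnm_lepP/subsetP => [le v vA|sub i]; last first.
  by rewrite !mnmE; case: (boolP (_ \in A)) => // /sub ->.
by have := le (enum_rank v); rewrite !mnmE enum_rankK vA; case: (v \in B).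
Qed.

Lemma mnm_set_subset A B m :
  A \subset B -> (mnm_set B <= m)%MM -> (mnm_set A <= m)%MM.
Proof. by rewrite -mnm_set_le => h1 h2; apply: lepm_trans h1 h2. Qed.

Lemma mnm_setU A B m :
  (mnm_set (A :|: B) <= m)%MM = (mnm_set A <= m)%MM && (mnm_set B <= m)%MM.
Proof.
rewrite -lem_mlcm; congr (_ <= _)%MM; apply/mnmP => i; rewrite !mnmE inE.
by case: (_ \in A); case: (_ \in B).
Qed.

Lemma mnm_setD A B : A \subset B -> (mnm_set (B :\: A) + mnm_set A)%MM = mnm_set B.
Proof.
move=> /subsetP sub; apply/mnmP => i; rewrite !mnmE !inE.
by case: (boolP (_ \in A)) => [/sub ->|_] //=; rewrite addn0.
Qed.

Lemma mnm_setD_eq0 A B : A \subset B -> (mnm_set (B :\: A) == 0%MM) = (A == B).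
Proof.
by move=> sub; rewrite -mdeg_eq0 mdeg_mnm_set cards_eq0 setD_eq0 eqEsubset sub.
Qed.

Lemma mcoeffMX_if n (p : {mpoly k[n]}) u w :
  (p * 'X_[u])@_w = if (u <= w)%MM then p@_(w - u) else 0.
Proof.
have [le|nle] := boolP (u <= w)%MM.
  by rewrite -{1}(submK le) addmC mcoeffMX.
apply/eqP; rewrite mcoeff_eq0; apply: contra nle.
by rewrite (perm_mem (msuppMX p u)) => /mapP[m' _ ->]; rewrite lem_addr.
Qed.

End SquarefreeMonomials.

(** Terms cancel across the diagonal without dividing by 2, so characteristic 2 is included. *)
Lemma sum_antisym (V : zmodType) n (G : 'I_n -> 'I_n -> V) :
  (forall e, G e e = 0) -> (forall e f, G e f = - G f e) ->
  \sum_e \sum_f G e f = 0.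
Proof.
move=> G0 GN; pose L := \sum_(e < n) \sum_(f < n | (f < e)%N) G e f.
have -> : \sum_e \sum_f G e f = L + \sum_(e < n) \sum_(f < n | (e < f)%N) G e f.
  rewrite -big_split; apply: eq_bigr => e _ /=.
  rewrite (bigID (fun f : 'I_n => (f < e)%N)) /=; congr (_ + _).
  rewrite (bigD1 e) ?ltnn //= G0 add0r; apply: eq_bigl => f.
  by rewrite -leqNgt [RHS]ltn_neqAle eq_sym andbC.
rewrite (exchange_big_dep predT) //= /L -big_split big1 // => e _ /=.
by rewrite -big_split big1 //= => f _; rewrite GN addNr.
Qed.

(** * The Taylor complex and its exactness *)

Section Taylor.

Variables (k : fieldType) (V : finType) (n : nat) (E : 'I_n -> {set V}).
Local Notation R := {mpoly k[#|V|]}.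
Implicit Types (S T : {set 'I_n}) (e f : 'I_n).

Definition un S : {set V} := \bigcup_(i in S) E i.

Lemma unU1 e S : un (e |: S) = E e :|: un S.
Proof. by rewrite /un bigcup_setU big_set1. Qed.

Lemma un_subset S T : S \subset T -> un S \subset un T.
Proof.
by move=> /subsetP sub; apply/bigcupsP => e /sub eT; rewrite (bigcup_sup e).
Qed.

Lemma un_setU1 e S : un S \subset un (e |: S).
Proof. by rewrite un_subset // subsetUr. Qed.

Lemma un_setD1 e S : un (S :\ e) \subset un S.
Proof. by rewrite un_subset // subsetDl. Qed.

Definition sgn e S : k := (-1) ^+ #|[set f in S | (f < e)%N]|.

Lemma sgnU1 e f S : f \notin S -> sgn e (f |: S) = (-1) ^+ (f < e)%N * sgn e S.
Proof.
move=> fS; rewrite /sgn -exprD; congr (_ ^+ _).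
have [fe|fe] := boolP (f < e)%N.
  rewrite (_ : [set _ in _ | _] = f |: [set g in S | (g < e)%N]).
    by rewrite cardsU1 inE (negPf fS).
  by apply/setP => g; rewrite !inE; case: eqP => // ->; rewrite fe.
apply: eq_card => g; rewrite !inE; case: eqP => //= ->.
by rewrite (negPf fe) andbF.
Qed.

(** Deleting two edges in either order gives opposite signs; this yields [taylor_diffK]. *)
Lemma sgn_swap e f S : e != f -> e \notin S -> f \notin S ->
  sgn e S * sgn f (e |: S) = - (sgn f S * sgn e (f |: S)).
Proof.
move=> ef eS fS; rewrite !sgnU1 //.
case: (ltngtP e f) ef => [_ _|_ _|/val_inj->]; last by rewrite eqxx.
  by rewrite expr1 expr0 mul1r mulN1r mulrN mulrC.
by rewrite expr1 expr0 mul1r mulN1r mulrN opprK mulrC.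
Qed.

(** The sign rule for the contracting homotopy in [taylor_exact]. *)
Lemma sgn_cross e f S : e != f -> e \notin S -> f \notin S ->
  sgn f (e |: S) * sgn e (f |: S) = - (sgn e S * sgn f S).
Proof.
move=> ef eS fS; rewrite !sgnU1 //.
case: (ltngtP e f) ef => [_ _|_ _|/val_inj->]; last by rewrite eqxx.
  by rewrite expr1 expr0 mul1r mulN1r mulNr mulrC.
by rewrite expr1 expr0 mul1r mulN1r mulrN mulrC.
Qed.

Lemma sgn_sqr e S : sgn e S * sgn e S = 1.
Proof. by rewrite -expr2 sqrr_sign. Qed.

(** The sum has at most one term, as [S] and [T] determine [e]. *)
Definition taylor_coef S T : R :=
  \sum_(e in S | T == S :\ e) sgn e T *: 'X_[mnm_set (un S :\: un T)].

Definition level i : {set {set 'I_n}} := [set S : {set 'I_n} | #|S| == i].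

(** The coordinate at the basis vector of [S], extended by 0 to sets of other sizes so that no
    membership proof is needed. *)
Definition at_set i (v : 'rV[R]_#|level i|) S : R :=
  \sum_(a | enum_val a == S) v 0 a.

Lemma at_set_val i (v : 'rV_#|level i|) a : at_set v (enum_val a) = v 0 a.
Proof. by rewrite /at_set (big_pred1 a) // => b; rewrite /= (inj_eq enum_val_inj). Qed.

Lemma at_set_out i (v : 'rV_#|level i|) S : #|S| != i -> at_set v S = 0.
Proof.
move=> Si; rewrite /at_set big_pred0 // => a; apply: contraNF Si => /eqP<-.
by have := enum_valP a; rewrite inE.
Qed.

Lemma at_setP i (v w : 'rV_#|level i|) : at_set v =1 at_set w -> v = w.
Proof. by move=> e; apply/rowP => a; rewrite -!at_set_val e. Qed.

Lemma at_set_row i (c : {set 'I_n} -> R) S : #|S| = i ->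
  at_set (\row_(a < #|level i|) c (enum_val a)) S = c S.
Proof.
move=> Si; have SL : S \in level i by rewrite inE Si.
by rewrite -(enum_rankK_in SL SL) at_set_val mxE.
Qed.

Definition taylor_diff i : 'M[R]_(#|level i.+1|, #|level i|) :=
  \matrix_(a, b) taylor_coef (enum_val a) (enum_val b).

Lemma at_set_diff i (w : 'rV_#|level i.+1|) T :
  at_set (w *m taylor_diff i) T =
  \sum_(e | e \notin T)
    sgn e T *: (at_set w (e |: T) * 'X_[mnm_set (un (e |: T) :\: un T)]).
Proof.
have [Ti|Ti] := eqVneq #|T| i; last first.
  rewrite at_set_out // big1 // => e eT.
  by rewrite at_set_out ?mul0r ?scaler0 // cardsU1 eT.
have TL : T \in level i by rewrite inE Ti.
rewrite -{1}(enum_rankK_in TL TL) at_set_val mxE.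
under eq_bigr => a _ do rewrite mxE enum_rankK_in // -at_set_val.
rewrite -(big_enum_val (fun S => at_set w S * taylor_coef S T)) /=.
under eq_bigr => S _ do rewrite mulr_sumr.
rewrite (exchange_big_dep predT) //= [RHS]big_mkcond /=; apply: eq_bigr => e _.
case: (boolP (e \in T)) => [eT|eT] /=.
  rewrite big_pred0 // => S; apply/negP => /andP[_ /andP[_ /eqP eS]].
  by move: eT; rewrite eS !inE eqxx.
rewrite (big_pred1 (e |: T)) => [|S] /=; first by rewrite scalerAr.
rewrite inE; apply/idP/eqP => [/and3P[_ eS /eqP->]|->]; first by rewrite setD1K.
by rewrite cardsU1 eT Ti setU11 setU1K ?eqxx.
Qed.

Lemma taylor_diffK i : taylor_diff i.+1 *m taylor_diff i = 0.
Proof.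
suff h (w : 'rV_#|level i.+2|) : w *m (taylor_diff i.+1 *m taylor_diff i) = 0.
  by apply/row_matrixP => a; rewrite row0 rowE.
apply: at_setP => T; rewrite mulmxA at_set_diff.
transitivity (0 : R); last by rewrite /at_set big1 // => a _; rewrite mxE.
(* The contribution of the path from [f |: (e |: T)] to [T] that deletes [f] first and then [e]. *)
pose G e f : R := if [&& e \notin T, f \notin T & e != f] then
  (sgn e T * sgn f (e |: T)) *:
    (at_set w (f |: (e |: T)) * 'X_[mnm_set (un (f |: (e |: T)) :\: un T)]) else 0.
transitivity (\sum_e \sum_f G e f); last first.
  apply: sum_antisym => [e|e f]; first by rewrite /G eqxx !andbF.
  rewrite /G andbCA [f == e]eq_sym; case: and3P => [[fT eT ef]|_]; last by rewrite oppr0.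
  by rewrite sgn_swap // scaleNr setUCA.
rewrite big_mkcond /=; apply: eq_bigr => e _.
case: (boolP (e \in T)) => eT /=.
  by rewrite big1 // => f _; rewrite /G eT.
rewrite at_set_diff mulr_suml scaler_sumr big_mkcond /=; apply: eq_bigr => f _.
rewrite /G eT !inE negb_or eq_sym andbC; case: andP => // -[fT ef].
rewrite -scalerAl scalerA -mulrA -mpolyXD.
congr (_ *: (_ * 'X_[_])); apply/(@addIm _ (mnm_set (un T))).
by rewrite -addmA !mnm_setD ?un_setU1 // (subset_trans (un_setU1 e T)) ?un_setU1.
Qed.

Lemma taylor_diff_homog i a b u : u \in msupp (taylor_diff i a b) ->
  (mdeg u + #|un (enum_val b)|)%N = #|un (enum_val a)|.
Proof.
rewrite mxE => /msupp_sum_le /flatten_mapP[e].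
rewrite mem_filter => /andP[/andP[_ /eqP ->] _] /msuppZ_le.
rewrite msuppX inE => /eqP->.
by rewrite mdeg_mnm_set -!mdeg_mnm_set -mdegD mnm_setD // un_setD1.
Qed.

Lemma un_level0 (a : 'I_#|level 0|) : un (enum_val a) = set0.
Proof.
have := enum_valP a; rewrite inE cards_eq0 => /eqP->.
by rewrite /un big_set0.
Qed.

Lemma taylor_aug_homog (a : 'I_#|level 0|) u :
  u \in msupp ((const_mx 1 : 'cV[R]_#|level 0|) a 0) ->
  mdeg u = #|un (enum_val a)|.
Proof.
by rewrite mxE un_level0 cards0 msupp1 inE => /eqP->; rewrite mdeg0.
Qed.

Definition taylor : graded_free_seq k #|V| :=
  @GradedFreeSeq k #|V| (fun i => #|level i|)
    (fun i a => #|un (enum_val a)|) taylor_diff (const_mx 1)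
    taylor_diff_homog taylor_aug_homog.

(* The coefficient of v at e_S in multidegree m, where e_S has the multidegree
   of the product of the vertices in un S. *)
Definition mgcoef i (v : 'rV[R]_#|level i|) m S : k :=
  if (mnm_set (un S) <= m)%MM then (at_set v S)@_(m - mnm_set (un S)) else 0.

(** In a fixed multidegree the monomials disappear and the differential becomes a simplicial
    boundary operator. *)
Lemma mgcoef_diff i (w : 'rV_#|level i.+1|) m T :
  mgcoef (w *m taylor_diff i) m T =
  if (mnm_set (un T) <= m)%MM
  then \sum_(e | e \notin T) sgn e T * mgcoef w m (e |: T) else 0.
Proof.
rewrite /mgcoef; case: ifP => // leT.
rewrite at_set_diff raddf_sum /=; apply: eq_bigr => e eT.
rewrite mcoeffZ mcoeffMX_if; congr (_ * _).
have eU := mnm_setD (un_setU1 e T).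
rewrite submDA [(mnm_set (un T) + _)%MM]addmC eU; congr (if _ then _ else _).
rewrite -eU; apply/mnm_lepP/mnm_lepP => h i0.
  by rewrite mnmDE addnC -leq_subRL ?(mnm_lepP leT) // -mnmBE.
by rewrite mnmBE leq_subRL ?(mnm_lepP leT) // addnC -mnmDE.
Qed.

Lemma mgcoefP i (v w : 'rV_#|level i|) :
  (forall m S, #|S| = i -> (mnm_set (un S) <= m)%MM -> mgcoef v m S = mgcoef w m S) ->
  v = w.
Proof.
move=> h; apply: at_setP => S.
have [Si|Si] := eqVneq #|S| i; last by rewrite !at_set_out.
apply/mpolyP => u; have := h (u + mnm_set (un S))%MM S Si.
by rewrite /mgcoef lem_addl !addmK; apply.
Qed.

(** The bound [N] ensures that the prescribed coefficients form polynomials. *)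
Lemma mgcoef_exists i (c : 'X_{1..#|V|} -> {set 'I_n} -> k) N :
  (forall m S, (N <= mdeg m)%N -> c m S = 0) ->
  exists v : 'rV_#|level i|, forall m S, #|S| = i ->
    (mnm_set (un S) <= m)%MM -> mgcoef v m S = c m S.
Proof.
move=> cN; pose p S : R :=
  \sum_(u : 'X_{1..#|V| < N}) c (u + mnm_set (un S))%MM S *: 'X_[u].
have pE S u : (p S)@_u = c (u + mnm_set (un S))%MM S.
  have [lt|ge] := ltnP (mdeg u) N; first by rewrite (mcoeff_mpoly (fun u => c (u + _)%MM S)).
  rewrite cN; last by rewrite mdegD (leq_trans ge) // leq_addr.
  rewrite raddf_sum /= big1 // => v _; rewrite mcoeffZ mcoeffX.
  case: eqP ge => [<-|_ _]; last by rewrite mulr0.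
  by rewrite leqNgt bmdeg.
exists (\row_a p (enum_val a)) => m S Si le.
by rewrite /mgcoef le at_set_row // pE submK.
Qed.

Definition divisor (m : 'X_{1..#|V|}) : option 'I_n :=
  [pick e | (mnm_set (E e) <= m)%MM].

(* The cone over an edge dividing m contracts the multidegree m part. *)
Definition cone i (v : 'rV[R]_#|level i|) m S : k :=
  if divisor m is Some e then
    if e \in S then sgn e (S :\ e) * mgcoef v m (S :\ e) else 0
  else 0.

Lemma taylor_exact i (v : 'rV_#|level i.+1|) :
  v *m taylor_diff i = 0 -> exists w, v = w *m taylor_diff i.+1.
Proof.
move=> dv0.
(* A multidegree of total degree at least [N] exceeds the degree of every coordinate of [v], even
   after subtracting a union of edges. *)
pose N := (\sum_(T : {set 'I_n}) (msize (at_set v T) + #|V|))%N.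
have coneN m S : (N <= mdeg m)%N -> cone v m S = 0.
  rewrite /cone => Nm; case: divisor => // e; case: ifP => // eS.
  rewrite /mgcoef; case: ifP => le; last by rewrite mulr0.
  rewrite memN_msupp_eq0 ?mulr0 //; apply: contraL Nm => /msize_mdeg_lt lt.
  rewrite -ltnNge -(submK le) mdegD mdeg_mnm_set /N (bigD1 (S :\ e)) //=.
  by rewrite (leq_trans _ (leq_addr _ _)) // -addSn leq_add // max_card.
have [w wP] := mgcoef_exists i.+2 coneN.
exists w; apply: mgcoefP => m S Si le; rewrite mgcoef_diff le.
have wE e : e \notin S -> mgcoef w m (e |: S) = cone v m (e |: S).
  (* If the union of [e |: S] does not divide [m], both sides are 0: the cone edge divides [m], so
     removing it leaves a union that still does not. *)
  move=> eS; have [le'|nle] := boolP (mnm_set (un (e |: S)) <= m)%MM.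
    by rewrite wP // cardsU1 eS Si.
  rewrite [LHS]/mgcoef (negPf nle) /cone /divisor.
  case: pickP => // f fm; case: ifP => // fS.
  rewrite [mgcoef _ _ _](_ : _ = 0) ?mulr0 // /mgcoef; case: ifP => // le2.
  case/negP: nle; rewrite -(setD1K fS) unU1 mnm_setU fm //=.
under eq_bigr => e eS do rewrite wE //.
have [e em] : exists e, divisor m = Some e.
  rewrite /divisor; case: pickP => [e _|none]; first by exists e.
  have [e eS] : exists e, e \in S by apply/set0Pn; rewrite -cards_eq0 Si.
  have := none e; rewrite (mnm_set_subset _ le) //.
  by rewrite /un (bigcup_sup e).
have eP : (mnm_set (E e) <= m)%MM.
  by move: em; rewrite /divisor; case: pickP => // f fm [<-].
rewrite /cone em; have [eS|eS] := boolP (e \in S); last first.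
  rewrite (bigD1 e) //= setU11 setU1K // mulrA sgn_sqr mul1r big1 ?addr0 //.
  move=> f /andP[_ fe]; rewrite !inE eq_sym (negPf fe) (negPf eS) mulr0 //.
(* For a cone edge in [S], the cycle condition at [S :\ e] expresses the coefficient of [v] at [S]
   through those at the other sets. *)
pose T := S :\ e; have eT : e \notin T by rewrite !inE eqxx.
have ST : S = e |: T by rewrite setD1K.
have leT : (mnm_set (un T) <= m)%MM by rewrite (mnm_set_subset _ le) // un_setD1.
have : mgcoef (v *m taylor_diff i) m T = 0.
  rewrite dv0 /mgcoef /at_set big1 ?mcoeff0 ?if_same // => a _; exact: mxE.
rewrite mgcoef_diff leT (bigD1 e) //= -ST => /eqP.
rewrite addr_eq0 => /eqP h.
rewrite -[LHS]mul1r -(sgn_sqr e T) -mulrA h mulrN mulr_sumr -sumrN.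
have cond f : (f \notin T) && (f != e) = (f \notin S).
  by rewrite ST !inE negb_or andbC.
rewrite big_mkcond [RHS]big_mkcond; apply: eq_bigr => f _ /=.
rewrite cond; case: ifP => // fS.
move: (fS); rewrite -cond => /andP[fT fe].
have -> : (f |: S) :\ e = f |: T.
  rewrite setDUl -/T; congr (_ :|: _); apply/setP => g; rewrite !inE.
  by case: (g =P f) => [->|]; rewrite ?fe ?andbF.
by rewrite in_setU eS orbT !mulrA ST sgn_cross 1?eq_sym // mulNr.
Qed.

Definition taylor_gens : 'cV[R]_n := \col_e 'X_[mnm_set (E e)].

Lemma taylor_gens_homog :
  homog_mx (fun e => #|E e|) (fun _ => 0%N) taylor_gens.
Proof.
by move=> e j u; rewrite mxE msuppX inE => /eqP->; rewrite mdeg_mnm_set addn0.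
Qed.

Lemma taylor_resolves (I : R -> Prop) :
  (forall p, I p <-> exists c : 'rV_n, p = (c *m taylor_gens) 0 0) ->
  resolves taylor I.
Proof.
move=> idealP.
have S0 : set0 \in level 0 by rewrite inE cards0.
have augE (v : 'rV[R]_#|level 0|) : (v *m aug taylor) 0 0 = at_set v set0.
  rewrite mxE; apply: eq_big => [a|a _]; last by rewrite mxE mulr1.
  by have := enum_valP a; rewrite inE cards_eq0 => ->.
have diff0E (w : 'rV[R]_#|level 1|) :
    at_set (w *m taylor_diff 0) set0 =
    ((\row_e at_set w [set e]) *m taylor_gens) 0 0.
  rewrite at_set_diff mxE; apply: eq_big => [e|e _]; first by rewrite inE.
  rewrite !mxE setU0 /un big_set0 big_set1 setD0 /sgn.
  by rewrite eq_card0 ?scale1r // => f; rewrite !inE.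
split=> [p|v|i v]; last 1 first.
- split; first exact: taylor_exact.
  by case=> w ->; rewrite -mulmxA taylor_diffK mulmx0.
- exists (\row_(a < #|level 0|) p); apply/idealP; exists 0.
  by rewrite augE (at_set_row (fun=> p)) ?cards0 // subrr mul0mx mxE.
rewrite augE idealP; split=> [[c e]|[w ->]]; last first.
  by exists (\row_e at_set w [set e]); rewrite diff0E.
pose cc (S : {set 'I_n}) : R := \sum_(e in S) c 0 e.
exists (\row_a cc (enum_val a)); apply: at_setP => S.
have [/eqP|Si] := eqVneq #|S| 0%N; last by rewrite !at_set_out.
rewrite cards_eq0 => /eqP->; rewrite e diff0E; congr ((_ *m _) _ _).
by apply/rowP => f; rewrite mxE at_set_row ?cards1 // /cc big_set1.
Qed.

End Taylor.

(** * Discrete Morse theory for the Taylor resolution *)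

(** If a combination of the rows in [B] vanishes, take [y] of least weight in its support: the
    column [g y] then has a single non-zero contribution. *)
Lemma triangular_rank (k : fieldType) a b (M : 'M[k]_(a, b)) (B : {set 'I_a})
    (g : 'I_a -> 'I_b) (wt : 'I_a -> nat) :
  {in B, forall x, M x (g x) != 0} ->
  {in B &, forall x y, x != y -> M x (g y) != 0 -> (wt x < wt y)%N} ->
  (#|B| <= \rank M)%N.
Proof.
move=> diag0 lower; pose N := rowsub (enum_val : 'I_#|B| -> 'I_a) M.
suff <- : \rank N = #|B| by rewrite /N rowsubE mxrankM_maxr.
apply/eqP; rewrite -/(row_free N) -kermx_eq0; apply/negPn/negP => /rowV0Pn[v].
move=> /sub_kermxP vN v0.
have [x0 vx0] : exists x, v 0 x != 0.
  by apply/rV0Pn.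
have [y vy ymin] := @arg_minnP _ x0 (fun x => v 0 x != 0) (fun x => wt (enum_val x)) vx0.
have := congr1 (fun r : 'rV_b => r 0 (g (enum_val y))) vN; rewrite !mxE.
rewrite (bigD1 y) //= big1 ?addr0 => [/eqP|x xy].
  by rewrite mxE mulf_eq0 (negPf vy) /= (negPf (diag0 _ (enum_valP y))).
rewrite mxE; have [->|vx] := eqVneq (v 0 x) 0; first by rewrite mul0r.
have [->|Mxy] := eqVneq (M (enum_val x) (g (enum_val y))) 0; first by rewrite mulr0.
have := ymin x vx; rewrite leqNgt lower ?enum_valP //.
by rewrite (inj_eq enum_val_inj).
Qed.

Lemma mxrank_sum_le (k : fieldType) (I : Type) (r : seq I) (P : pred I) a b
    (F : I -> 'M[k]_(a, b)) :
  (\rank (\sum_(i <- r | P i) F i)%R <= \sum_(i <- r | P i) \rank (F i))%N.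
Proof.
elim/big_rec2: _ => [|i x y _ IH]; first by rewrite mxrank0.
by rewrite (leq_trans (mxrank_add _ _)) // leq_add2l.
Qed.

Section Selection.

Variables (k : fieldType) (n : nat).
Implicit Types (S : {set 'I_n}) (P Q : pred {set 'I_n}).

Definition select i P : 'M[k]_#|level n i| := diag_mx (\row_a (P (enum_val a))%:R).

Lemma selectE i P a c : select i P a c = (P (enum_val a) && (a == c))%:R.
Proof. by rewrite !mxE; case: eqP; case: (P _); rewrite ?mulr1n ?mulr0n. Qed.

Lemma select_mul i b P (M : 'M_(#|level n i|, b)) a c :
  (select i P *m M) a c = (P (enum_val a))%:R * M a c.
Proof. by rewrite mul_diag_mx !mxE. Qed.

Lemma mul_select i b P (M : 'M_(b, #|level n i|)) c a :
  (M *m select i P) c a = M c a * (P (enum_val a))%:R.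
Proof. by rewrite mul_mx_diag !mxE. Qed.

Definition num P i := #|[set S : {set 'I_n} | (#|S| == i) && P S]|.

Lemma num_level P i : num P i = #|[set a : 'I_#|level n i| | P (enum_val a)]|.
Proof.
rewrite -(card_imset _ (@enum_val_inj _ (mem (level n i)))); apply: eq_card => S.
rewrite inE; apply/andP/imsetP => [[Si PS]|[a]]; last first.
  by rewrite inE => Pa ->; split=> //; have := enum_valP a; rewrite inE.
have SL : S \in level n i by rewrite inE.
by exists (enum_rank_in SL S); rewrite ?inE enum_rankK_in.
Qed.

(** The lower bound is applied to [P] and to its complement, whose selections have product 0. *)
Lemma rank_select i P : \rank (select i P) = num P i.
Proof.
have ge Q : (num Q i <= \rank (select i Q))%N.
  rewrite num_level; apply: (@triangular_rank _ _ _ _ _ id (fun=> 0%N)).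
    by move=> a; rewrite inE selectE eqxx andbT => ->; rewrite oner_neq0.
  by move=> a b _ _ /negPf ab; rewrite selectE ab andbF eqxx.
apply/eqP; rewrite eqn_leq ge andbT.
have PQ0 : select i P *m select i (predC P) = 0.
  apply/matrixP => a b; rewrite select_mul selectE !mxE /=.
  by case: (P _); rewrite ?mulr0 ?mul0r.
have total : (num P i + num (predC P) i = #|level n i|)%N.
  rewrite !num_level -[RHS]card_ord -(cardsC [set a | P (enum_val a)]); congr (_ + _)%N.
  by apply: eq_card => a; rewrite !inE.
have h2 := mulmx0_rank_max PQ0; have h1 := ge (predC P).
rewrite -(leq_add2r (num (predC P) i)) total.
by apply: leq_trans h2; rewrite leq_add2l.
Qed.

End Selection.

Section DiscreteMorse.

Variables (k : fieldType) (V : finType) (n : nat) (E : 'I_n -> {set V}).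
Implicit Types (S T : {set 'I_n}) (e f : 'I_n).
Variables (pivot : {set 'I_n} -> option 'I_n) (wt : {set 'I_n} -> nat).

Hypothesis pivot_un : forall S e, pivot S = Some e -> un E (e |: S) = un E (S :\ e).
Hypothesis pivot_toggle : forall S e, pivot S = Some e ->
  pivot (e |: S) = Some e /\ pivot (S :\ e) = Some e.
Hypothesis pivot_acyclic : forall S T e e' f,
  pivot S = Some e -> e \in S -> pivot T = Some e' -> e' \in T -> S != T ->
  f \in S -> S :\ f = T :\ e' -> un E (S :\ f) = un E S -> (wt S < wt T)%N.
(** This leaves no room for a differential between critical sets of the same multidegree. *)
Hypothesis critical_sizes : forall S T, pivot S = None -> pivot T = None ->
  un E S = un E T -> #|T| <> #|S|.+1.

Local Notation tay := (taylor k E).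
Local Notation select := (select k).

Lemma tdiff_taylorE i a b : tdiff tay i a b =
  \sum_(e in enum_val a | enum_val b == enum_val a :\ e)
    (sgn k e (enum_val b) * (un E (enum_val a) == un E (enum_val b))%:R).
Proof.
rewrite /tdiff !mxE /= raddf_sum; apply: eq_bigr => e /andP[_ /eqP->] /=.
rewrite mcoeffZ mcoeffX mnm_setD_eq0 ?un_setD1 //; congr (_ * _%:R).
by rewrite eq_sym.
Qed.

Lemma tdiff_taylor_neq0 i a b : tdiff tay i a b != 0 ->
  exists e, [/\ e \in (enum_val a : {set 'I_n}), enum_val b = enum_val a :\ e &
                un E (enum_val b) = un E (enum_val a)].
Proof.
rewrite tdiff_taylorE; have [/eqP <-|ne] := boolP (un E _ == _); last first.
  by rewrite big1 ?eqxx // => e _; rewrite mulr0.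
case: (pickP (fun e => (e \in (enum_val a : {set 'I_n})) && (enum_val b == enum_val a :\ e))).
  by move=> e /andP[ea /eqP eb] _; exists e.
by move=> none; rewrite big_pred0 ?eqxx.
Qed.

Definition rk_on (P : pred {set 'I_n}) i := \rank (select i.+1 P *m tdiff tay i).

Definition up S := if pivot S is Some e then e \in S else false.
Definition down S := if pivot S is Some e then e \notin S else false.
Definition toggle_down S := if pivot S is Some e then S :\ e else S.

Definition num_up P i := num (fun S => P S && up S) i.
Definition num_crit P i := num (fun S => P S && (pivot S == None)) i.

Section OnUnion.

Variable Q : pred {set V}.
Local Notation P := (fun S : {set 'I_n} => Q (un E S)).

(** The matched pairs, ordered by [wt], form a triangular submatrix with signs on the diagonal. *)
Lemma num_up_le_rk i : (num_up P i.+1 <= rk_on P i)%N.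
Proof.
rewrite /num_up num_level /rk_on.
pose BB := [set a : 'I_#|level n i.+1| | P (enum_val a) && up (enum_val a)].
have [B0|[a0]] := set_0Vmem BB; first by rewrite -/BB B0 cards0.
have downL a : a \in BB -> toggle_down (enum_val a) \in level n i.
  rewrite !inE /up /toggle_down => /andP[_].
  case: (pivot _) => // e ea; have := enum_valP a; rewrite inE (cardsD1 e) ea.
  by rewrite eqSS.
move=> /downL L0.
pose g (a : 'I_#|level n i.+1|) := enum_rank_in L0 (toggle_down (enum_val a)).
have gE a : a \in BB -> enum_val (g a) = toggle_down (enum_val a).
  by move=> /downL L; rewrite enum_rankK_in.
apply: (triangular_rank (g := g) (wt := fun a => wt (enum_val a))).
  move=> a aB; rewrite select_mul tdiff_taylorE (gE a aB).
  move: aB; rewrite inE /up /toggle_down => /andP[->].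
  case epv: (pivot _) => [e|//] ea; rewrite mul1r.
  have := pivot_un epv; rewrite (setUidPr _) ?sub1set // => <-.
  rewrite eqxx (big_pred1 e) => [|f] /=.
    by rewrite mulr1 signr_eq0.
  apply/andP/eqP => [[fa /eqP eq]|->//]; apply/eqP; apply: contraT => fe.
  by have := setD11 f (enum_val a); rewrite -eq !inE fe fa.
move=> a b aB bB ab; rewrite select_mul mulf_eq0 negb_or => /andP[_].
case/tdiff_taylor_neq0 => f [fa]; rewrite (gE b bB).
move: aB bB; rewrite !inE /up /toggle_down.
case ea: (pivot (enum_val a)) => [e|]; rewrite ?andbF // => /andP[_ eS].
case eb: (pivot (enum_val b)) => [e'|]; rewrite ?andbF // => /andP[_ eT] eq unE.
apply: (pivot_acyclic ea eS eb eT _ fa (esym eq)); last by rewrite -eq.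
by rewrite (inj_eq enum_val_inj).
Qed.

(** Lower members of matched pairs are counted by their partners, one level up. *)
Lemma num_split i : num P i = (num_crit P i + num_up P i + num_up P i.+1)%N.
Proof.
have -> : num_up P i.+1 = num (fun S => P S && down S) i.
  rewrite /num_up /num -(card_in_imset (f := toggle_down)); last first.
    move=> S T; rewrite !inE /up /toggle_down.
    case eS: (pivot S) => [e|]; rewrite ?andbF //= => /and3P[_ _ eSin].
    case eT: (pivot T) => [e'|]; rewrite ?andbF //= => /and3P[_ _ eTin] eq.
    have [_ ] := pivot_toggle eS; rewrite eq.
    have [_ ->] := pivot_toggle eT => -[ee].
    by rewrite -(setD1K eSin) eq -ee setD1K.
  apply: eq_card => T; rewrite !inE; apply/imsetP/idP => [[S]|].
    rewrite !inE /up /down /toggle_down.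
    case eS: (pivot S) => [e|]; rewrite ?andbF //= => /and3P[Si PS eSin] ->.
    have [_ ->] := pivot_toggle eS; rewrite -(pivot_un eS).
    rewrite !inE eqxx /= andbT (setUidPr _) ?sub1set // PS andbT.
    by move: Si; rewrite (cardsD1 e) eSin.
  rewrite /down; case eT: (pivot T) => [e|]; rewrite ?andbF //= => /and3P[Ti PT eTin].
  have [p1 _] := pivot_toggle eT; exists (e |: T).
    rewrite !inE /up p1 setU11 cardsU1 eTin (eqP Ti) eqxx (pivot_un eT) /= andbT.
    by rewrite (setDidPl _) // disjoint_sym disjoints1.
  by rewrite /toggle_down p1 setU1K.
rewrite /num_crit /num_up /num.
rewrite -(cardsID [set S | pivot S == None]) -addnA; congr (_ + _)%N.
  by apply: eq_card => S; rewrite !inE andbA.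
rewrite -(cardsID [set S | up S]); congr (_ + _)%N; apply: eq_card => S; rewrite !inE.
  by rewrite /up /=; case: (pivot S) => //= *; rewrite ?andbF ?andbT // andbA.
by rewrite /up /down; case: (pivot S) => [e|] /=; rewrite ?andbF ?andbT // andbC andbA.
Qed.

Lemma select_tdiff i : select i.+1 P *m tdiff tay i = tdiff tay i *m select i P.
Proof.
apply/matrixP => a b; rewrite select_mul mul_select.
have [->|] := eqVneq (tdiff tay i a b) 0; first by rewrite mulr0 mul0r.
by case/tdiff_taylor_neq0 => e [_ _ ->]; rewrite mulrC.
Qed.

Lemma rk_on_0 : (rk_on P 0 <= num P 0)%N.
Proof. by rewrite -(rank_select k) /rk_on select_tdiff mxrankM_maxr. Qed.

Lemma tdiff_taylorK i : tdiff tay i.+1 *m tdiff tay i = 0.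
Proof. by rewrite !tdiffE -residueM /= taylor_diffK residue0. Qed.

Lemma rk_on_S i : (rk_on P i.+1 + rk_on P i <= num P i.+1)%N.
Proof.
rewrite -(rank_select k) -(mxrank_mul_ker (select i.+1 P) (tdiff tay i)).
rewrite addnC leq_add2l mxrankS // sub_capmx {1}select_tdiff submxMl.
by apply/sub_kermxP; rewrite -mulmxA tdiff_taylorK mulmx0.
Qed.

Lemma num_up0 : num_up P 0 = 0%N.
Proof.
apply/eqP; rewrite cards_eq0; apply/eqP/setP => S; rewrite !inE.
apply/negP => /and3P[]; rewrite cards_eq0 => /eqP->; rewrite /up.
by case: (pivot _) => // e _; rewrite inE.
Qed.

(* Every rank is at least the number of matched pairs, while two consecutive
   ranks add up to at most the number of sets in between. *)
Lemma rk_on_no_crit i : num_crit P i = 0%N \/ num_crit P i.+1 = 0%N ->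
  rk_on P i = num_up P i.+1.
Proof.
move=> crit0; apply/eqP; rewrite eqn_leq num_up_le_rk andbT.
case: crit0 => c0; last first.
  have := rk_on_S i; rewrite num_split c0 add0n [X in (_ <= X)%N]addnC => h.
  rewrite -(leq_add2l (num_up P i.+2)); apply: leq_trans h.
  by rewrite leq_add2r num_up_le_rk.
case: i c0 => [|i] c0.
  by have := rk_on_0; rewrite num_split c0 num_up0.
have := rk_on_S i; rewrite num_split c0 add0n addnC => h.
rewrite -(leq_add2l (num_up P i.+1)); apply: leq_trans h.
by rewrite leq_add2r num_up_le_rk.
Qed.

End OnUnion.

Local Notation of_card j := (fun S : {set 'I_n} => #|un E S| == j).

(** Degree [j] is split into the multidegrees [W] of size [j], because [critical_sizes] only
    compares sets with the same union. *)
Lemma rk_on_card i j : rk_on (of_card j) i = num_up (of_card j) i.+1.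
Proof.
rewrite /rk_on; apply/eqP; rewrite eqn_leq (num_up_le_rk (fun W : {set V} => #|W| == j)) andbT.
have -> : select i.+1 (of_card j) =
      \sum_(W : {set V} | #|W| == j) select i.+1 (fun S => un E S == W).
  apply/matrixP => a b; rewrite selectE summxE.
  under eq_bigr => W _ do rewrite selectE.
  have [uj|uj] /= := boolP (#|un E (enum_val a)| == j).
    rewrite (bigD1 (un E (enum_val a))) //= eqxx big1 ?addr0 // => W /andP[_].
    by rewrite eq_sym => /negPf->.
  rewrite big1 // => W Wj; rewrite (negPf (_ : un E (enum_val a) != W)) //.
  by apply: contraNneq uj => ->.
rewrite mulmx_suml; apply: leq_trans (mxrank_sum_le _ _ _) _.
have -> : num_up (of_card j) i.+1 =
    (\sum_(W : {set V} | #|W| == j) num_up (fun S => un E S == W) i.+1)%N.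
  rewrite /num_up /num -sum1_card.
  rewrite (partition_big (un E) (fun W : {set V} => #|W| == j)) => [|S]; last first.
    by rewrite inE => /and3P[].
  apply: eq_bigr => W /eqP Wj; rewrite sum1_card; apply: eq_card => S.
  rewrite [LHS]unfold_in /= !inE.
  by case: (un E S =P W) => [->|_] /=; rewrite ?Wj ?eqxx ?andbT ?andbF.
apply: leq_sum => W _; rewrite -/(rk_on _ i).
rewrite (rk_on_no_crit (Q := pred1 W)) //.
have [|] := eqVneq (num_crit (fun S => un E S == W) i) 0%N; first by left.
rewrite /num_crit /num cards_eq0 => /set0Pn[S]; rewrite !inE => /and3P[/eqP Si /eqP SW /eqP Sc].
right; apply/eqP; rewrite cards_eq0; apply/eqP/setP => T; rewrite !inE.
apply/negP => /and3P[/eqP Ti /eqP TW /eqP Tc].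
by apply: (critical_sizes Sc Tc); rewrite ?SW ?TW // Ti Si.
Qed.

Lemma taylor_tor_dim i j : tor_dim tay i j = num_crit (of_card j) i.
Proof.
have tpartE l : tpart tay l j = select l (of_card j) by [].
have split l := num_split (fun W : {set V} => #|W| == j) l.
have -> : tor_dim tay i j = (\rank (tcycles tay i j) - num_up (of_card j) i.+1)%N.
  by rewrite -rk_on_card.
case: i => [|i] /=.
  by rewrite tpartE rank_select split (num_up0 (fun W => #|W| == j)) addn0 addnK.
have := mxrank_mul_ker (tpart tay i.+1 j) (tdiff tay i).
rewrite tpartE rank_select -/(rk_on _ i) rk_on_card split => h.
apply/eqP; rewrite -(eqn_add2l (num_up (of_card j) i.+1)).
rewrite addnBA; last first.
  rewrite -(leq_add2l (num_up (of_card j) i.+1)) h leq_add2r leq_addl //.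
by rewrite h addnK addnC.
Qed.

End DiscreteMorse.

(** * Hypercycles *)

Section Hypercycle.

Variables (k : fieldType) (m alpha : nat) (H : hypergraph).
Hypothesis m_ge2 : (2 <= m)%N.
Local Notation n := m.+1.
Hypothesis triangle : n = 3%N -> forall v : vertex H,
  (#|[set E in edges H | v \in E]| <= 2)%N.
Variable E : 'I_n -> {set vertex H}.
Hypothesis unifH : uniform (2 * alpha) H.
Hypothesis edgesE : edges H = [set E i | i : 'I_n].
Hypothesis adjE : forall i j : 'I_n, i != j ->
  (E i :&: E j != set0 <-> (j.+1 = i %[mod n])%N \/ (j = i.+1 %[mod n])%N).
Hypothesis meetE : forall i j : 'I_n, nat_of_ord j = i.+1 -> #|E i :&: E j| = alpha.
Hypothesis meetE0 : forall i j : 'I_n, nat_of_ord i = 0%N -> j.+1 = n ->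
  #|E i :&: E j| = alpha.
Implicit Types (S T : {set 'I_n}) (u v : 'I_n).

Local Notation suc v := (inZp (nat_of_ord v).+1 : 'I_n).
Local Notation pre v := (inZp (nat_of_ord v + m)%N : 'I_n).

(** The vertex [v] of the abstract cycle stands for this block, so that edge [v] consists of the
    blocks [v] and [v + 1]. *)
Definition block v := E (pre v) :&: E v.

Lemma edge_in i : E i \in edges H.
Proof. by rewrite edgesE imset_f. Qed.

Lemma card_edge i : #|E i| = (2 * alpha)%N.
Proof. exact/unifH/edge_in. Qed.

Lemma alpha_gt0 : (0 < alpha)%N.
Proof. by have := edges_gt1 (edge_in ord0); rewrite card_edge; lia. Qed.

Lemma card_block v : #|block v| = alpha.
Proof.
rewrite /block; have [v0|v0] := posnP v.
  rewrite setIC; apply: meetE0 => //.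
  by rewrite v0 add0n /= modn_small.
apply: meetE; rewrite /= -[in RHS](prednK v0) addSnnS modnDr modn_small ?prednK //.
by rewrite (leq_trans _ (ltn_ord v)) // ltnS leq_pred.
Qed.

Lemma adjacentP i j : i != j -> E i :&: E j != set0 -> i = suc j \/ j = suc i.
Proof.
move=> ij /(adjE ij)[] h; [left | right]; apply/val_inj => /=.
  by rewrite h modn_small.
by rewrite -h modn_small.
Qed.

(** Equal edges would be neighbours and meet in [2 * alpha] vertices instead of [alpha]. *)
Lemma edge_inj : injective E.
Proof.
move=> i j eE; apply/eqP; apply: contraT => ij; have a0 := alpha_gt0.
have nE : E i :&: E j != set0 by rewrite -eE setIid -cards_eq0 card_edge; lia.
have h u : E (pre u) = E u -> False.
  move=> e; have := card_block u; rewrite /block e setIid card_edge; lia.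
by case: (adjacentP ij nE) => e; [case: (h i) | case: (h j)]; rewrite {1}e sucK eE.
Qed.

(** A common vertex lies on three consecutive edges, so the outer two meet. Being neighbours, they
    force [n = 3], where [triangle] forbids a vertex on all three edges. *)
Lemma block_suc v : block v :&: block (suc v) = set0.
Proof.
rewrite /block sucK; apply/eqP/negPn/negP => /set0Pn[x].
rewrite !inE => /andP[/andP[xp xv] /andP[_ xs]].
have ps : pre v != suc v.
  apply/eqP => /inZp_inj_mod /eqP; rewrite -(addn1 v) eqn_modDl.
  by rewrite !modn_small //; lia.
have nE : E (pre v) :&: E (suc v) != set0 by apply/set0Pn; exists x; rewrite inE xp.
case: (adjacentP ps nE) => e; last first.
  by move: e; rewrite preK => e; have := succ_neq m_ge2 v; rewrite e eqxx.
have n3 : n = 3%N.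
  have := congr1 (fun w : 'I_n => suc w) e; rewrite preK !(inZpS, inZpS2) => e3.
  have /eqP : (v + 0 = v + 3 %[mod n])%N by rewrite addn0 addn3; apply/inZp_inj_mod; rewrite valZpK.
  rewrite eqn_modDl mod0n; have [lt|] := ltnP 3 n; last by lia.
  by rewrite modn_small.
have := triangle n3 x; rewrite leqNgt => /negP; apply.
have sub : [set E i | i in [set pre v; v; suc v]] \subset [set F in edges H | x \in F].
  apply/subsetP => F /imsetP[i iS ->]; rewrite inE edge_in /=.
  by move: iS; rewrite !inE => /orP[/orP[]|] /eqP->.
apply: leq_trans (subset_leq_card sub); rewrite card_imset; last exact: edge_inj.
rewrite -setUA cardsU1 !inE negb_or (pred_neq m_ge2) ps /= cards2 eq_sym.
by rewrite (succ_neq m_ge2).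
Qed.

Lemma block_disjoint u v x : x \in block u -> x \in block v -> u = v.
Proof.
move=> xu xv; apply/eqP; apply: contraT => uv.
have nE : E u :&: E v != set0.
  by apply/set0Pn; exists x; move: xu xv; rewrite !inE => /andP[_ ->] /andP[_ ->].
have abs w : x \in block w -> x \in block (suc w) -> False.
  by move=> h1 h2; have := in_set0 x; rewrite -(block_suc w) inE h1 h2.
by case: (adjacentP uv nE) => e; [case: (abs v) | case: (abs u)]; rewrite -?e.
Qed.

Lemma edge_blocks i : E i = block i :|: block (suc i).
Proof.
apply/esym/eqP; rewrite eqEcard; apply/andP; split.
  by apply/subsetP => x; rewrite /block sucK !inE => /orP[]/andP[].
by rewrite cardsU block_suc cards0 subn0 !card_block card_edge; lia.
Qed.

Lemma un_covered S : un E S = \bigcup_(v in covered S) block v.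
Proof.
apply/setP => x; apply/bigcupP/bigcupP => [[i iS]|[v]].
  rewrite edge_blocks inE => /orP[] xb; first by exists i; rewrite // inE iS.
  by exists (suc i) => //; rewrite inE sucK iS orbT.
rewrite inE => /orP[vS|pS] xb; first by exists v; rewrite // edge_blocks inE xb.
by exists (pre v) => //; rewrite edge_blocks inE preK xb orbT.
Qed.

(** The blocks are non-empty and pairwise disjoint, so a union of blocks determines which ones
    occur. *)
Lemma un_eq S T : un E S = un E T <-> covered S = covered T.
Proof.
split=> [e|e]; last by rewrite !un_covered e.
have sub S' T' : un E S' = un E T' -> covered S' \subset covered T'.
  move=> e'; apply/subsetP => v vS.
  have [x xv] : exists x, x \in block v.
    by apply/set0Pn; rewrite -card_gt0 card_block alpha_gt0.
  have : x \in un E S' by rewrite un_covered; apply/bigcupP; exists v.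
  rewrite e' un_covered => /bigcupP[w wT xw].
  by rewrite (block_disjoint xv xw).
by apply/eqP; rewrite eqEsubset !sub.
Qed.

Lemma card_un S : #|un E S| = (alpha * #|covered S|)%N.
Proof.
rewrite un_covered.
have -> : #|\bigcup_(v in covered S) block v| = (\sum_(v in covered S) #|block v|)%N.
  have h (s : seq 'I_n) : uniq s ->
      #|\bigcup_(v <- s) block v| = (\sum_(v <- s) #|block v|)%N.
    elim: s => [|v s IH] /=; first by rewrite !big_nil cards0.
    case/andP => vs us; rewrite !big_cons cardsU IH // (_ : _ :&: _ = set0) ?cards0 ?subn0 //.
    apply/setP => x; rewrite [RHS]inE inE; apply/negP => /andP[xv].
    rewrite bigcup_seq => /bigcupP[w ws xw].
    by move: vs; rewrite (block_disjoint xv xw) ws.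
  by rewrite -[in LHS]big_enum h ?enum_uniq // big_enum.
by rewrite (eq_bigr (fun=> alpha)) => [|v _]; rewrite ?card_block // sum_nat_const mulnC.
Qed.

Lemma set_monomialE (F : {set vertex H}) :
  set_monomial k F = 'X_[mnm_set F].
Proof.
rewrite mpolyXE_id (reindex (@enum_rank (vertex H))) /=; last first.
  by exists enum_val => x _; rewrite ?enum_rankK ?enum_valK.
rewrite /set_monomial big_mkcond /=; apply: eq_bigr => v _.
by rewrite mnmE enum_rankK; case: (v \in F).
Qed.

Lemma edge_idealP (p : {mpoly k[#|vertex H|]}) : edge_ideal p <->
  exists c : 'rV_n, p = (c *m taylor_gens k E) 0 0.
Proof.
have sumE c : \sum_(F in edges H) c F * set_monomial k F =
    ((\row_i c (E i)) *m taylor_gens k E) 0 0.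
  rewrite edgesE big_imset /=; last by move=> i j _ _; exact: edge_inj.
  by rewrite mxE; apply: eq_bigr => i _; rewrite !mxE set_monomialE.
split=> [[c ->]|[c ->]]; first by exists (\row_i c (E i)); rewrite sumE.
exists (fun F => if [pick i | E i == F] is Some i then c 0 i else 0).
rewrite sumE; congr ((_ *m _) _ _); apply/rowP => i; rewrite mxE.
case: pickP => [j /eqP/edge_inj->//|/(_ i)]; by rewrite eqxx.
Qed.

Local Notation crit i e :=
  [set S : {set 'I_n} | [&& pivot S == None, #|S| == i & #|un E S| == e]].
Local Notation ccrit i j :=
  [set S : {set 'I_n} | [&& pivot S == None, #|S| == i & #|covered S| == j]].

Lemma betti_crit i e : betti (edge_ideal (k := k) (H := H)) i e = #|crit i e|.
Proof.
rewrite (betti_tor_dim (@taylor_gens_homog k _ _ E) edge_idealP _ _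
  (taylor_resolves edge_idealP)).
rewrite (@taylor_tor_dim k _ _ E (@pivot m) (@weight m)).
- by apply: eq_card => S; rewrite !inE andbA andbC.
- by move=> S f /(pivot_cover m_ge2)/un_eq.
- by move=> S f pS; split; [case: (pivot_setU1 m_ge2 pS) | case: (pivot_setD1 m_ge2 pS)].
- move=> S T f f' g pS fS pT fT ST gS eq /un_eq ceq.
  exact: (weight_lt m_ge2 pS fS pT fT ST gS eq ceq).
move=> S T pS pT /un_eq ceq; rewrite (critical_same_card m_ge2 pS pT ceq).
by move=> /n_Sn.
Qed.

Lemma betti_ccrit i j :
  betti (edge_ideal (k := k) (H := H)) i (alpha * j)%N = #|ccrit i j|.
Proof.
rewrite betti_crit; apply: eq_card => S; rewrite !inE card_un.
by rewrite eqn_pmul2l // alpha_gt0.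
Qed.

Lemma covered_full S : #|covered S| = n -> covered S = setT.
Proof.
by move=> cS; apply/eqP; rewrite eqEcard subsetT cardsT card_ord cS leqnn.
Qed.

Lemma binz_nat a b : binz a%:Z b%:Z = 'C(a, b).
Proof.
rewrite /binz lez_nat /=; case: leqP => // ba; by rewrite bin_small.
Qed.

Lemma betti_nonfull i j : (j < n)%N -> (j <= 2 * i)%N ->
  (betti (edge_ideal (k := k) (H := H)) i (alpha * j)%N)%:R =
    n%:R / (n%:Z - 2 * (j%:Z - i%:Z))%:~R
    * (binz (j%:Z - i%:Z) (2 * i%:Z - j%:Z))%:R
    * (binz (n%:Z - 2 * (j%:Z - i%:Z)) (j%:Z - i%:Z))%:R :> rat.
Proof.
(* For [j < i] the first binomial coefficient is 0, and no critical set exists since a set covers at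
   least as many blocks as it has edges. *)
move=> jn ji; rewrite betti_ccrit; have [ij|ij] := leqP i j; last first.
  have -> : binz (j%:Z - i%:Z) (2 * i%:Z - j%:Z) = 0%N.
    by rewrite /binz; case: ifP => //; lia.
  rewrite mulr0 mul0r; apply/eqP; rewrite pnatr_eq0 cards_eq0.
  apply/eqP/setP => S; rewrite !inE; apply/negP => /and3P[_ /eqP Si /eqP cS].
  by have := card_cover S; rewrite cS Si; lia.
rewrite card_nonfull_crit //; pose r := (j - i)%N.
have -> : j%:Z - i%:Z = r%:Z by rewrite /r; lia.
have -> : 2 * i%:Z - j%:Z = (2 * i - j)%N%:Z by lia.
(* For [n <= 2 * r] there is no spaced set of size [r], and the last binomial coefficient is 0, also
   where the denominator vanishes. *)
rewrite -/r binz_nat; have [rn|rn] := ltnP (2 * r) n; last first.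
  rewrite num_spaced_eq0 // mul0n.
  have -> : binz (n%:Z - 2 * r%:Z) r%:Z = 0%N by rewrite /binz; case: ifP => //; lia.
  by rewrite mulr0.
have -> : n%:Z - 2 * r%:Z = (n - 2 * r)%N%:Z by lia.
rewrite binz_nat natrM mulrAC; congr (_ * _).
have a0 : (n - 2 * r)%N%:R != 0 :> rat by rewrite pnatr_eq0; lia.
apply: (mulfI a0); rewrite -natrM num_spacedE // natrM pmulrn.
by rewrite mulrA mulrCA mulfV ?mulr1.
Qed.

Lemma full_critE i S : (S \in ccrit i n) = (#|S| == i) &&
  ((S == full_crit m 0) && (n %% 3 != 1)%N || (S == full_crit m 1) && (n %% 3 != 2)%N).
Proof.
rewrite inE; apply/and3P/andP => [[/eqP pS -> /eqP/covered_full cS]|[-> F]].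
  by split=> //; case: (full_crit_sub m_ge2 cS pS) => -[-> ->]; rewrite eqxx ?orbT.
have [c [-> hc]] : exists c, S = full_crit m c /\
    ((c == 0%N) && (n %% 3 != 1)%N || (c == 1%N) && (n %% 3 != 2)%N).
  by case/orP: F => /andP[/eqP-> n3]; [exists 0%N | exists 1%N]; rewrite n3.
by rewrite pivot_full_crit // cover_full_crit // cardsT card_ord.
Qed.

Lemma betti_full1 i : (n %% 3 = 1)%N ->
  betti (edge_ideal (k := k) (H := H)) i (alpha * n)%N = (i == (2 * n + 1) %/ 3)%N.
Proof.
move=> n3; rewrite betti_ccrit.
have cF : #|full_crit m 1| = ((2 * n + 1) %/ 3)%N by rewrite card_full_crit //=; lia.
case: eqP => [iE|ne]; last first.
  apply: eq_card0 => S; rewrite full_critE n3 /= andbF andbT.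
  by apply/negP => /andP[/eqP Si /eqP SF]; apply: ne; rewrite -Si SF cF.
rewrite -[RHS](cards1 (full_crit m 1)); apply: eq_card => S.
rewrite full_critE n3 /= andbF andbT inE.
by case: (S =P _) => [->|]; rewrite ?andbF // cF iE eqxx.
Qed.

Lemma betti_full2 i : (n %% 3 = 2)%N ->
  betti (edge_ideal (k := k) (H := H)) i (alpha * n)%N = (i == (2 * n - 1) %/ 3)%N.
Proof.
move=> n3; rewrite betti_ccrit.
have cF : #|full_crit m 0| = ((2 * n - 1) %/ 3)%N by rewrite card_full_crit //=; lia.
case: eqP => [iE|ne]; last first.
  apply: eq_card0 => S; rewrite full_critE n3 /= andbF orbF andbT.
  by apply/negP => /andP[/eqP Si /eqP SF]; apply: ne; rewrite -Si SF cF.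
rewrite -[RHS](cards1 (full_crit m 0)); apply: eq_card => S.
rewrite full_critE n3 /= andbF orbF andbT inE.
by case: (S =P _) => [->|]; rewrite ?andbF // cF iE eqxx.
Qed.

Lemma betti_full0 i : (n %% 3 = 0)%N ->
  betti (edge_ideal (k := k) (H := H)) i (alpha * n)%N = (2 * (i == 2 * n %/ 3))%N.
Proof.
move=> n3; rewrite betti_ccrit.
have cF0 : #|full_crit m 0| = (2 * n %/ 3)%N by rewrite card_full_crit //=; lia.
have cF1 : #|full_crit m 1| = (2 * n %/ 3)%N by rewrite card_full_crit //=; lia.
case: eqP => [iE|ne]; last first.
  apply: eq_card0 => S; rewrite full_critE n3 /= !andbT.
  by apply/negP => /andP[/eqP Si /orP[]/eqP SF]; apply: ne; rewrite -Si SF ?cF0 ?cF1.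
transitivity #|[set full_crit m 0; full_crit m 1]|; last by rewrite cards2 full_crit_neq.
apply: eq_card => S; rewrite full_critE n3 /= !andbT !inE.
case: (S =P full_crit m 0) => [->|_]; first by rewrite cF0 iE eqxx.
by case: (S =P full_crit m 1) => [->|_]; rewrite ?andbF // cF1 iE eqxx.
Qed.

(** The degree counts covered blocks; there are at most twice as many as edges, since a set has at
    most as many runs as edges. *)
Lemma betti_support i e : betti (edge_ideal (k := k) (H := H)) i e <> 0%N ->
  exists j, [/\ (j <= n)%N, (j <= 2 * i)%N & e = (alpha * j)%N].
Proof.
rewrite betti_crit => /eqP; rewrite cards_eq0 => /set0Pn[S].
rewrite inE card_un => /and3P[_ /eqP Si /eqP eS].
exists #|covered S|; split=> //; first by rewrite -[X in (_ <= X)%N]card_ord max_card.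
rewrite card_cover Si mul2n -addnn leq_add2l -Si.
by apply/subset_leq_card/subsetP => v; rewrite inE => /andP[].
Qed.

End Hypercycle.

Theorem theorem3p12 (k : fieldType) (n d alpha : nat) (H : hypergraph)
  (n_ge3 : (3 <= n)%N)
  (triangle : n = 3%N -> forall v : vertex H,
     (#|[set E in edges H | v \in E]| <= 2)%N)
  (cycleH : is_hypercycle n d alpha H)
  (d_eq : d = (2 * alpha)%N) :
  let beta := betti (edge_ideal (k := k) (H := H)) in
  [/\ (* the non-zero Betti numbers are among those listed below *)
      forall i e : nat, beta i e <> 0%N ->
        exists j : nat, [/\ (j <= n)%N, e = (alpha * j)%N &
          [\/ (j < n)%N /\ (j <= 2 * i)%N,
              [/\ j = n, (n = 1 %[mod 3])%N & i = ((2 * n + 1) %/ 3)%N],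
              [/\ j = n, (n = 2 %[mod 3])%N & i = ((2 * n - 1) %/ 3)%N] |
              [/\ j = n, (n = 0 %[mod 3])%N & i = (2 * n %/ 3)%N]]],
      forall i j : nat, (j < n)%N -> (j <= 2 * i)%N ->
        (beta i (alpha * j)%N)%:R =
          n%:R / (n%:Z - 2 * (j%:Z - i%:Z))%:~R
          * (binz (j%:Z - i%:Z) (2 * i%:Z - j%:Z))%:R
          * (binz (n%:Z - 2 * (j%:Z - i%:Z)) (j%:Z - i%:Z))%:R :> rat,
      (n = 1 %[mod 3])%N -> beta ((2 * n + 1) %/ 3)%N (alpha * n)%N = 1%N,
      (n = 2 %[mod 3])%N -> beta ((2 * n - 1) %/ 3)%N (alpha * n)%N = 1%N &
      (n = 0 %[mod 3])%N -> beta (2 * n %/ 3)%N (alpha * n)%N = 2%N].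
Proof.
move=> beta; subst d; case: n n_ge3 triangle cycleH => [//|m] m_ge2 triangle.
case=> unifH [E [edgesE _ adjE meetE meetE0]].
have full1 := betti_full1 k m_ge2 triangle unifH edgesE adjE meetE meetE0.
have full2 := betti_full2 k m_ge2 triangle unifH edgesE adjE meetE meetE0.
have full0 := betti_full0 k m_ge2 triangle unifH edgesE adjE meetE meetE0.
split=> [i e b0|i j jn ji|n3|n3|n3].
- have [j [jn ji eE]] := betti_support m_ge2 triangle unifH edgesE adjE meetE meetE0 b0.
  exists j; split=> //; move: jn; rewrite leq_eqVlt => /orP[/eqP jn|jn]; last first.
    by constructor 1.
  rewrite eE jn /beta in b0.
  have [n3|n3|n3] : [\/ (m.+1 %% 3 = 1)%N, (m.+1 %% 3 = 2)%N | (m.+1 %% 3 = 0)%N].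
    have : (m.+1 %% 3 < 3)%N by rewrite ltn_mod.
    by case: (m.+1 %% 3)%N => [|[|[|]]] // _; [constructor 3|constructor 1|constructor 2].
  + by constructor 2; split=> //; move: b0; rewrite full1 //; case: eqP.
  + by constructor 3; split=> //; move: b0; rewrite full2 //; case: eqP.
  + by constructor 4; split=> //; move: b0; rewrite full0 //; case: eqP.
- exact (betti_nonfull k m_ge2 triangle unifH edgesE adjE meetE meetE0 jn ji).
- by rewrite /beta full1 // eqxx.
- by rewrite /beta full2 // eqxx.
by rewrite /beta full0 // eqxx.
Qed.
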